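(* Let $M_1,\ldots,M_s$ be $m\times m$ positive semidefinite matrices such that $\sum_{k=1}^sM_k$ has full rank $m$, let $N\ge1$ be an integer, let $p\in[0,1]$, and let $\boldsymbol{w}^*$ be an optimal solution of the continuous problem $$\max\Big\{\Phi_p\big(M_F(\boldsymbol{w})\big):\ \boldsymbol{w}\in\mathbb{R}_+^s,\ \sum_{k=1}^sw_k\le N\Big\}.$$ Let $\boldsymbol{n}$ be the vector returned by the incremental rounding algorithm for the input $\boldsymbol{w}=\boldsymbol{w}^*$, and let $\boldsymbol{n}^*$ be an optimal solution of $\max\{\varphi_p(\boldsymbol{n}'):\ \boldsymbol{n}'\in\mathbb{N}^s,\ \sum_in'_i\le N\}$. Then $$\frac{\varphi_p(\boldsymbol{n})}{\varphi_p(\boldsymbol{n}^* )}\ \ge\ \frac{\varphi_p(\boldsymbol{n})}{\varphi_p(\boldsymbol{w}^* )}\ \ge\ F,$$ where $F$ is defined by $$F=\begin{cases}\left(\frac Ns\right)^{1-p} & \text{if }\left(\frac Ns\right)^{1-p}\le\frac1{2-p}\quad\text{(in particular, if }\frac Ns\le e^{-1}\text{)},\\[1ex] 1-\frac sN(1-p)\left(\frac1{2-p}\right)^{\frac{2-p}{1-p}} & \text{otherwise}\quad\text{(in particular, if }\frac Ns\ge\frac12\text{)}.\end{cases}$$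
   Context: $[s]:=\{1,\ldots,s\}$, $\mathbb{N}$ contains $0$; positive semidefinite matrices are real symmetric. For $\boldsymbol{w}\in\mathbb{R}_+^s$, $M_F(\boldsymbol{w}):=\sum_{i=1}^sw_iM_i$. For an $m\times m$ positive semidefinite matrix $M$ with eigenvalues $\lambda_1,\dots,\lambda_m$ (with multiplicities), $\operatorname{trace}M^p:=\sum_k\lambda_k^p$ if $p\in(0,1]$ and $\operatorname{trace}M^0:=\operatorname{rank}M$. The criterion is $\Phi_p(M)=\big(\frac1m\operatorname{trace}M^p\big)^{1/p}$ for $p\in(0,1]$, and $\Phi_0(M)=(\det M)^{1/m}$. Moreover $\varphi_p(\boldsymbol{w}):=\operatorname{trace}M_F(\boldsymbol{w})^p$ for $\boldsymbol{w}\in\mathbb{R}_+^s$ (in particular for vectors in $\mathbb{N}^s$); it is a rank when $p=0$. Incremental rounding algorithm. Input: a nonnegative vector $\boldsymbol{w}\in\mathbb{R}^s$ with $\sum_iw_i=N$, $N$ a positive integer. Sort the coordinates so that $w_1\ge w_2\ge\cdots\ge w_s$. Start from $\boldsymbol{n}=(1,0,\ldots,0)$. For $k=2,\ldots,N$: select an index $i_{\max}\in\operatorname{argmax}_{i\in[s]}\big((n_i+1)^p-n_i^p\big)w_i^{1-p}$ and replace $n_{i_{\max}}$ by $n_{i_{\max}}+1$. Return $\boldsymbol{n}$ (indexed consistently with the matrices). For the scalar powers $n_i^p$ and $w_i^{1-p}$ the convention $0^0=0$ is adopted.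
   Formalization: The remark that N/s ≥ 1/2 gives the ''otherwise'' case fails for p = 1 and for p = 0, N/s = 1/2, where the first condition holds with equality; these are excluded, and F is shown to equal the second formula for all N/s ≥ 1/2 (read as 1 at p = 1). *)

(* Defs.v *)
From HB Require Import structures.
From mathcomp Require Import all_boot all_order all_fingroup all_algebra.
From mathcomp Require Import all_classical all_reals all_analysis.
Set Implicit Arguments.
Unset Strict Implicit.
Unset Printing Implicit Defensive.
Import Order.TTheory GRing.Theory Num.Theory.
Local Open Scope ring_scope.

Definition psd (R : realType) (m : nat) (A : 'M[R]_m) : Prop :=
  A^T = A /\ forall x : 'cV[R]_m, 0 <= (x^T *m A *m x) 0 0.

(* The eigenvalues with multiplicities, in an unspecified order. A real
   symmetric matrix has a split characteristic polynomial, so the default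
   value [::] plays no role for positive semidefinite matrices. *)
Definition eigenvalues (R : realType) (m : nat) (A : 'M[R]_m) : seq R :=
  xget [::] [set lam : seq R | char_poly A = \prod_(x <- lam) ('X - x%:P)]%classic.

Definition trace_pow (R : realType) (m : nat) (p : R) (A : 'M[R]_m) : R :=
  if p == 0 then (\rank A)%:R else \sum_(x <- eigenvalues A) x `^ p.

Definition Phi (R : realType) (m : nat) (p : R) (A : 'M[R]_m) : R :=
  if p == 0 then (\det A) `^ (m%:R^-1)
  else (m%:R^-1 * trace_pow p A) `^ (p^-1).

Definition info_mx (R : realType) (s m : nat) (M : 'I_s -> 'M[R]_m)
    (w : 'I_s -> R) : 'M[R]_m :=
  \sum_(i < s) w i *: M i.

Definition phi (R : realType) (s m : nat) (M : 'I_s -> 'M[R]_m) (p : R)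
    (w : 'I_s -> R) : R :=
  trace_pow p (info_mx M w).

Definition natv (R : realType) (s : nat) (n : 'I_s -> nat) : 'I_s -> R :=
  fun i => (n i)%:R.

Definition feasible (R : realType) (s N : nat) (w : 'I_s -> R) : Prop :=
  (forall i, 0 <= w i) /\ \sum_(i < s) w i <= N%:R.

Definition continuous_optimal (R : realType) (s m : nat)
    (M : 'I_s -> 'M[R]_m) (p : R) (N : nat) (w : 'I_s -> R) : Prop :=
  feasible N w /\
  forall w' : 'I_s -> R, feasible N w' ->
    Phi p (info_mx M w') <= Phi p (info_mx M w).

Definition integer_optimal (R : realType) (s m : nat)
    (M : 'I_s -> 'M[R]_m) (p : R) (N : nat) (n : 'I_s -> nat) : Prop :=
  (\sum_(i < s) n i <= N)%N /\
  forall n' : 'I_s -> nat, (\sum_(i < s) n' i <= N)%N ->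
    phi M p (natv R n') <= phi M p (natv R n).

(* Power with the convention 0^0 = 0, whereas the library has 0 `^ 0 = 1. *)
Definition pow00 (R : realType) (x a : R) : R :=
  if x == 0 then 0 else x `^ a.

Definition gain (R : realType) (s : nat) (p : R) (w : 'I_s -> R)
    (n : 'I_s -> nat) (i : 'I_s) : R :=
  (pow00 (n i).+1%:R p - pow00 (n i)%:R p) * pow00 (w i) (1 - p).

(* [greedy_run p w k n]: on sorted weights w, n is a possible value of the
   current vector once k units have been allocated; ties in the argmax may be
   broken arbitrarily. *)
Inductive greedy_run (R : realType) (s : nat) (p : R) (w : 'I_s -> R) :
    nat -> ('I_s -> nat) -> Prop :=
| greedy_start :
    greedy_run p w 1 (fun i => ((i : nat) == 0)%N : nat)
| greedy_step (k : nat) (n : 'I_s -> nat) (imax : 'I_s) :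
    greedy_run p w k n ->
    (forall i, gain p w n i <= gain p w n imax) ->
    greedy_run p w k.+1 (fun i => n i + (i == imax))%N.

(* sigma lists the original indices in an order making the weights
   nonincreasing (any such order is allowed); n is the result transported back
   to the original indexing. *)
Definition rounding_output (R : realType) (s : nat) (p : R) (N : nat)
    (w : 'I_s -> R) (n : 'I_s -> nat) : Prop :=
  exists (sigma : {perm 'I_s}) (n' : 'I_s -> nat),
    [/\ forall i j : 'I_s, (i <= j)%N -> w (sigma j) <= w (sigma i),
        greedy_run p (fun i => w (sigma i)) N n' &
        forall i, n (sigma i) = n' i].

Definition Fcond (R : realType) (p : R) (N s : nat) : bool :=
  (N%:R / s%:R) `^ (1 - p) <= (2 - p)^-1.

Definition Fsmall (R : realType) (p : R) (N s : nat) : R :=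
  (N%:R / s%:R) `^ (1 - p).

(* The exponent is a junk division for p = 1, but then [Fcond] holds. *)
Definition Flarge (R : realType) (p : R) (N s : nat) : R :=
  1 - s%:R / N%:R * (1 - p) * ((2 - p)^-1) `^ ((2 - p) / (1 - p)).

Definition Fbound (R : realType) (p : R) (N s : nat) : R :=
  if Fcond p N s then Fsmall p N s else Flarge p N s.

(* Main.v *)
Require Import Defs.
From HB Require Import structures.
From mathcomp Require Import all_boot all_order all_fingroup all_algebra.
From mathcomp Require Import all_classical all_reals all_analysis.
From mathcomp Require Import complex ring lra.
Set Implicit Arguments.
Unset Strict Implicit.
Unset Printing Implicit Defensive.
Import Order.TTheory GRing.Theory Num.Theory.
Import numFieldNormedType.Exports.
Local Open Scope classical_set_scope.
Local Open Scope ring_scope.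

(* The quantity S = \sum_i n_i^p w_i^(1-p), where w = w*, separates the matrix
   part of the inequality from its scalar part.

   phi_p(n) >= (S / N) phi_p(w).  For p > 0, phi_p is homogeneous of degree p
   and has diminishing returns: for p < 1, t^p is a mixture of the functions
   ln (1 + c t), and A |-> ln det (1 + c A) has diminishing returns because
   inversion is antitone.  Follow the path y(r)_i = min(n_i, r w_i).  It stays below r w, so
   a small increment h has at least the gain it has at r w - h; there
   optimality of w and homogeneity bound phi_p, and the gain is at least
   p r^(p-1) (\sum h / N) phi_p(w) to first order.  Summing over the path
   yields S.  For p = 0, let V collect the terms of M_F(w) with n_i > 0: moving
   weight off V multiplies the determinant by at least (1 - t)^(rank V), which
   optimality of w bounds by (1 - t a)^m with a = S / N; let t tend to 0.

   S >= N F.  The greedy vector maximizes S, with a Lagrange multiplier for the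
   budget, hence S dominates the sum of the chords of k |-> k^p w_i^(1-p) at
   w_i.  Each chord dominates the tangents of slope at most 1 to x^(2-p); the
   two cases of F are the tangent at N/s and the tangent of slope 1. *)

(** * Tangent inequalities for real powers *)

(** Bernoulli's inequality, through concavity of ln: with L = 1 + p (z - 1), apply [ln x <= x - 1]
    at z / L and 1 / L with weights p and 1 - p; the right-hand sides then add up to 0. *)
Lemma powR_le_tangent1 (R : realType) (p z : R) :
  0 <= p -> p <= 1 -> 0 <= z -> z `^ p <= 1 + p * (z - 1).
Proof.
move=> p0 p1; rewrite le_eqVlt => /predU1P[<-|z0].
  have [->|pn0] := eqVneq p 0; first by rewrite powRr0; lra.
  by rewrite powR0//; lra.
have y0 : 0 < 1 + p * (z - 1).
  have [->|pn0] := eqVneq p 0; first by lra.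
  have : 0 < p * z by rewrite mulr_gt0// lt_neqAle eq_sym pn0.
  lra.
have lnle (x : R) : 0 < x -> ln x <= x - 1.
  by move=> x0; rewrite -{1}(subrKC 1 x); apply: le_ln1Dx; lra.
set L := 1 + _ in y0 *.
rewrite /powR gt_eqF// -[leRHS](@lnK R) ?posrE// ler_expR.
have := lnle (z / L) (divr_gt0 z0 y0).
have := lnle L^-1; rewrite invr_gt0 => /(_ y0).
rewrite ln_div ?posrE// lnV ?posrE// => h1 h2.
have h3 : p * (z / L - 1) + (1 - p) * (L^-1 - 1) = 0.
  by rewrite /L; field; rewrite gt_eqF.
have : 0 <= (1 - p) * (L^-1 - 1 + ln L) by rewrite mulr_ge0//; lra.
have : 0 <= p * (z / L - 1 - (ln z - ln L)) by rewrite mulr_ge0//; lra.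
lra.
Qed.

Lemma powR_le_tangent (R : realType) (p x y : R) :
  0 <= p -> p <= 1 -> 0 < x -> 0 <= y ->
  y `^ p <= x `^ p + p * x `^ (p - 1) * (y - x).
Proof.
move=> p0 p1 x0 y0.
have := @powR_le_tangent1 R p (y / x) p0 p1 (divr_ge0 y0 (ltW x0)).
have xp : 0 < x `^ p by exact: powR_gt0.
rewrite -(ler_pM2l xp) -powRM ?divr_ge0 ?(ltW x0)// mulrCA divff ?gt_eqF// mulr1.
move=> /le_trans; apply.
rewrite powRB ?(gt_eqF x0) ?implybT// powRr1 ?(ltW x0)//.
by rewrite le_eqVlt; apply/orP; left; apply/eqP; field; rewrite gt_eqF.
Qed.

(** Bernoulli's inequality with exponent 1/p, applied to (y/x)^p. *)
Lemma powR_ge_tangent (R : realType) (p x y : R) :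
  1 <= p -> 0 < x -> 0 <= y ->
  x `^ p + p * x `^ (p - 1) * (y - x) <= y `^ p.
Proof.
move=> p1 x0 y0; have p0 : 0 < p by lra.
have xp : 0 < x `^ p by exact: powR_gt0.
have z0 := divr_ge0 y0 (ltW x0).
have := @powR_le_tangent1 R p^-1 ((y / x) `^ p) _ _ (powR_ge0 _ _).
rewrite -powRrM mulfV ?gt_eqF// powRr1// invr_ge0 (ltW p0) invf_le1// => /(_ isT p1).
rewrite -(ler_pM2l p0) => h.
have {}h : 1 + p * (y / x - 1) <= (y / x) `^ p.
  have : p * (1 + p^-1 * ((y / x) `^ p - 1)) = p - 1 + (y / x) `^ p by field; rewrite gt_eqF.
  lra.
move: h; rewrite -(ler_pM2l xp) -powRM ?(ltW x0)// mulrCA divff ?gt_eqF// mulr1.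
apply: le_trans.
rewrite powRB ?(gt_eqF x0) ?implybT// powRr1 ?(ltW x0)//.
by rewrite le_eqVlt; apply/orP; left; apply/eqP; field; rewrite gt_eqF.
Qed.

(** With y = (1 - p) (z - 1), Bernoulli for the exponent 1 - p gives z <= (1 + y) z^p, and (1 + y)
    (1 - y) <= 1. *)
Lemma powR_ge_quad (R : realType) (p z : R) : 0 <= p -> p <= 1 -> 0 < z ->
  z + (1 - p) * z * (1 - z) <= z `^ p.
Proof.
move=> p0 p1 z0.
have u := @powR_le_tangent1 R (1 - p) z _ _ (ltW z0).
have {u} : z `^ (1 - p) <= 1 + (1 - p) * (z - 1) by apply: u; lra.
rewrite powRB ?(gt_eqF z0) ?implybT// powRr1 ?(ltW z0)// ler_pdivrMr ?powR_gt0// => u.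
set y := (1 - p) * (z - 1) in u *.
rewrite (_ : z + _ = z * (1 - y)); last by rewrite /y; ring.
have y1 : 0 < 1 + y.
  have h : 0 <= (1 - p) * z by rewrite mulr_ge0 ?(ltW z0)//; lra.
  rewrite /y; have [p00|pn0] := eqVneq p 0; first by rewrite p00; lra.
  have : 0 < p by rewrite lt_neqAle eq_sym pn0.
  lra.
rewrite -(ler_pM2l y1); apply: le_trans u.
rewrite mulrCA -{2}(mulr1 z) ler_pM2l//; nra.
Qed.

Lemma half_powR_le (R : realType) (u : R) : 0 <= u -> u <= 1 ->
  (2^-1) `^ u <= 1 - u / 2.
Proof.
move=> u0 u1; have := @powR_le_tangent1 R u 2^-1 u0 u1 _; rewrite invr_ge0 => /(_ (ler0n _ _)).
lra.
Qed.

Lemma pow00E (R : realType) (x a : R) : x != 0 -> pow00 x a = x `^ a.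
Proof. by rewrite /pow00 => /negbTE ->. Qed.

Lemma pow000 (R : realType) (a : R) : pow00 0 a = 0 :> R.
Proof. by rewrite /pow00 eqxx. Qed.

Lemma pow001 (R : realType) (a : R) : pow00 1 a = 1 :> R.
Proof. by rewrite pow00E ?oner_eq0// powR1. Qed.

(** Divide both nodes of the chord by w and apply [powR_ge_quad] to the ratios. The linear parts
    average to w; the quadratic parts leave the variance term f (1 - f) / w, at most 1/4 because w
    >= 1. *)
Lemma chord_ge_quad (R : realType) (p f : R) (k : nat) :
  0 <= p -> p <= 1 -> 0 <= f -> f <= 1 ->
  k.+1%:R + f - (1 - p) / 4 <=
    (k.+1%:R + f) `^ (1 - p) * ((1 - f) * k.+1%:R `^ p + f * k.+2%:R `^ p).
Proof.
move=> p0 p1 f0 f1; set w := (_ + f).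
have k1 : 1 <= k.+1%:R :> R by rewrite ler1n.
have k2 : k.+2%:R = k.+1%:R + 1 :> R by rewrite natr1.
set K := k.+1%:R in k1 k2 w *.
have w1 : 1 <= w by rewrite /w; lra.
have w0 : 0 < w by lra.
have wE x : 0 < x -> w `^ (1 - p) * x `^ p = w * (x / w) `^ p.
  move=> x0; rewrite powRM ?invr_ge0 ?(ltW w0) ?(ltW x0)//.
  rewrite powRB ?(gt_eqF w0) ?implybT// powRr1 ?(ltW w0)//.
  by rewrite -(powR_inv1 (ltW w0)) -powRrM mulN1r powRN; ring.
rewrite mulrDr ![_ `^ (1 - p) * (_ * _)]mulrCA k2 !wE; [|lra|lra].
have ha := @powR_ge_quad R p (K / w) p0 p1 _.
have hb := @powR_ge_quad R p ((K + 1) / w) p0 p1 _.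
have {}ha := ha (divr_gt0 (lt_le_trans ltr01 k1) w0).
have {}hb : (K + 1) / w + (1 - p) * ((K + 1) / w) * (1 - (K + 1) / w) <= ((K + 1) / w) `^ p.
  by apply: hb; apply: divr_gt0 => //; lra.
apply: (@le_trans _ _ ((1 - f) * (w * (K / w + (1 - p) * (K / w) * (1 - K / w)))
   + f * (w * ((K + 1) / w + (1 - p) * ((K + 1) / w) * (1 - (K + 1) / w))))); last first.
  by apply: lerD; apply: ler_wpM2l; rewrite ?subr_ge0// ler_wpM2l// ltW.
have -> : (1 - f) * (w * (K / w + (1 - p) * (K / w) * (1 - K / w)))
   + f * (w * ((K + 1) / w + (1 - p) * ((K + 1) / w) * (1 - (K + 1) / w)))
   = w - (1 - p) * (f * (1 - f) / w).
  by rewrite /w; field; rewrite nat1r; exact: (lt0r_neq0 w0).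
rewrite lerD2l lerN2; apply: ler_wpM2l; first lra.
rewrite ler_pdivrMr//.
have : 0 <= (f - 2^-1) ^+ 2 by exact: sqr_ge0.
rewrite expr2; nra.
Qed.

(** On [0, 1] the chord is x^(2-p) itself, a convex function above its tangents. Beyond 1, the
    tangent is at most (1/2)^(2-p) at 1/2 and has slope at most 1, so at w it is at most w -
    (1-p)/4, which [chord_ge_quad] covers. *)
Lemma chord_ge_line (R : realType) (p x0 f : R) (k : nat) :
  0 <= p -> p <= 1 -> 0 < x0 -> (2 - p) * x0 `^ (1 - p) <= 1 ->
  0 <= f -> f <= 1 ->
  x0 `^ (2 - p) + (2 - p) * x0 `^ (1 - p) * (k%:R + f - x0) <=
    pow00 (k%:R + f) (1 - p) * ((1 - f) * pow00 k%:R p + f * pow00 k.+1%:R p).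
Proof.
move=> p0 p1 x00 sig f0 f1.
have tan y : 0 <= y ->
    x0 `^ (2 - p) + (2 - p) * x0 `^ (1 - p) * (y - x0) <= y `^ (2 - p).
  move=> y0; rewrite (_ : 1 - p = 2 - p - 1); last by ring.
  by apply: powR_ge_tangent => //; lra.
case: k => [|k].
  (* The convention 0^0 = 0 makes this chord start at 0 even for p = 0. *)
  rewrite add0r pow000 pow001 mulr0 add0r mulr1; have [->|fn0] := eqVneq f 0.
    rewrite mulr0; apply: le_trans (tan 0 (lexx 0)) _.
    by rewrite powR0//; lra.
  rewrite pow00E//; suff -> : f `^ (1 - p) * f = f `^ (2 - p) by exact: tan.
  have -> : 2 - p = (1 - p) + 1 by ring.
  by rewrite [RHS]powRD ?fn0 ?implybT// powRr1.
rewrite !pow00E ?pnatr_eq0//; last by rewrite gt_eqF// ltr_wpDr.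
apply: le_trans (@chord_ge_quad R p f k p0 p1 f0 f1).
set w := _ + f.
have w1 : 1 <= w by rewrite /w -[leLHS]addr0 lerD// ler1n.
have h0 : 0 <= 2^-1 :> R by rewrite invr_ge0.
have := tan 2^-1 h0.
have half0 : 2^-1 != 0 :> R by rewrite invr_eq0 pnatr_eq0.
rewrite (_ : 2 - p = 1 + (1 - p)); last by ring.
rewrite (powRD (x := 2^-1)) ?half0 ?implybT// powRr1//.
have := @half_powR_le R (1 - p) _ _; rewrite subr_ge0 => /(_ p1) hh.
have {}hh : 2^-1 `^ (1 - p) <= 1 - (1 - p) / 2 by apply: hh; lra.
rewrite (_ : 1 + (1 - p) = 2 - p); last by ring.
move: sig; set sg := (2 - p) * _ => sig hl.
have : 0 <= (1 - sg) * (w - 2^-1) by rewrite mulr_ge0//; lra.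
nra.
Qed.

(** * The greedy vector *)

Lemma pow00_ge0 (R : realType) (x a : R) : 0 <= pow00 x a.
Proof. by rewrite /pow00; case: ifP => // _; exact: powR_ge0. Qed.

Lemma pow00_le (R : realType) (a x y : R) : 0 <= a -> 0 <= x -> x <= y ->
  pow00 x a <= pow00 y a.
Proof.
move=> a0 x0 xy; rewrite {1}/pow00; case: ifPn => [_|xn0]; first exact: pow00_ge0.
rewrite pow00E; first by apply: ge0_ler_powR; rewrite ?nnegrE// (le_trans x0).
by rewrite gt_eqF// (lt_le_trans _ xy)// lt_neqAle eq_sym xn0.
Qed.

Lemma pow00_increment_ge0 (R : realType) (p : R) (k : nat) : 0 <= p ->
  0 <= pow00 k.+1%:R p - pow00 k%:R p :> R.
Proof. by move=> p0; rewrite subr_ge0 pow00_le// ler_nat. Qed.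

(** Concavity of x^p: its tangent at l + 1 dominates both neighbours. For p = 0 the increments are
    1, 0, 0, ..., again because 0^0 = 0. *)
Lemma pow00_increment_le (R : realType) (p : R) (k l : nat) :
  0 <= p -> p <= 1 -> (k <= l)%N ->
  pow00 l.+1%:R p - pow00 l%:R p <= pow00 k.+1%:R p - pow00 k%:R p :> R.
Proof.
move=> p0 p1; elim: l => [|l IH]; first by rewrite leqn0 => /eqP ->.
rewrite leq_eqVlt => /predU1P[->//|]; rewrite ltnS => /IH; apply: le_trans.
have t y : 0 <= y -> y `^ p <= l.+1%:R `^ p + p * l.+1%:R `^ (p - 1) * (y - l.+1%:R) :> R.
  by apply: powR_le_tangent => //; rewrite ltr0n.
have l2 : l.+2%:R = l.+1%:R + 1 :> R by rewrite natr1.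
have l1 : l.+1%:R = l%:R + 1 :> R by rewrite natr1.
have {}h2 := t _ (ler0n R l.+2); have {t}h1 := t _ (ler0n R l).
have {}h1 : pow00 l%:R p <= l.+1%:R `^ p + p * l.+1%:R `^ (p - 1) * (l%:R - l.+1%:R) :> R.
  apply: le_trans h1; rewrite /pow00; case: ifP => // _; exact: powR_ge0.
rewrite (pow00E (x := l.+1%:R)) ?pnatr_eq0// pow00E ?pnatr_eq0//.
rewrite l2 l1; rewrite l2 l1 in h2; rewrite l1 in h1.
set c := p * _ in h2 h1; rewrite (_ : _ + 1 + 1 - _ = 1) in h2; last by ring.
rewrite (_ : l%:R - _ = - 1) in h1; last by ring.
lra.
Qed.

(** A slope between the forward and backward increments at n is a supergradient there; at n = 0
    there is no backward increment to respect. *)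
Lemma concave_seq_le_line (R : realType) (u : nat -> R) (n : nat) (lam : R) :
  (forall k l, (k <= l)%N -> u l.+1 - u l <= u k.+1 - u k) ->
  u n.+1 - u n <= lam -> ((0 < n)%N -> lam <= u n - u n.-1) ->
  forall k, u k <= u n + lam * (k%:R - n%:R).
Proof.
move=> conc up dn k; have [|] := leqP n k.
  elim: k => [|k IH]; first by rewrite leqn0 => /eqP ->; lra.
  rewrite leq_eqVlt => /predU1P[->|]; first lra.
  rewrite ltnS => nk; have := IH nk; have := conc _ _ nk; rewrite -natr1; lra.
have below j : (j <= n)%N -> u (n - j)%N <= u n - lam * j%:R.
  elim: j => [|j IH] jn; first by rewrite subn0; lra.
  have n0 : (0 < n)%N by apply: leq_ltn_trans jn.
  have := IH (ltnW jn); have := dn n0.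
  have : (n - j.+1 <= n.-1)%N by rewrite -subn1 leq_sub2l.
  move/conc; rewrite prednK// subnSK// -natr1; lra.
move=> /ltnW kn; have := below _ (leq_subr k n); rewrite subKn// natrB//; lra.
Qed.

(** The exchange invariant: no available gain exceeds that of the last unit given to any j. A step
    preserves it because gains only decrease and the new unit was chosen with maximal gain. *)
Lemma greedy_run_marginals (R : realType) (s : nat) (p : R) (w : 'I_s -> R)
    (N : nat) (n : 'I_s -> nat) :
  (0 < s)%N -> 0 <= p -> p <= 1 -> (forall i, 0 <= w i) ->
  (forall i j : 'I_s, (i <= j)%N -> w j <= w i) ->
  greedy_run p w N n ->
  (\sum_i n i = N)%N /\
  (forall i j, (0 < n j)%N -> gain p w n i <= gain p w (fun l => (n l).-1) j).
Proof.
move=> s0 p0 p1 w0 ws; elim=> [|k {}n imax run [IH1 IH2] hmax].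
  split.
    rewrite (bigD1 (Ordinal s0))//= big1 ?addn0// => i.
    by rewrite -val_eqE/= => /negbTE ->.
  (* The first unit is placed without comparing gains; sortedness of [w] makes coordinate 0 a
     maximizer. *)
  move=> i j; case: eqP => // j0 _; rewrite /gain /= j0 eqxx /=.
  apply: ler_pM.
  - exact: pow00_increment_ge0.
  - exact: pow00_ge0.
  - exact: pow00_increment_le.
  - by apply: pow00_le; rewrite ?subr_ge0 ?ws ?j0.
split.
  rewrite big_split/= IH1 -addn1; congr addn.
  by rewrite (bigD1 imax)//= eqxx big1 ?addn0// => i /negbTE ->.
move=> i j nj; apply: (@le_trans _ _ (gain p w n i)).
  apply: ler_wpM2r; first exact: pow00_ge0.
  by apply: pow00_increment_le => //; exact: leq_addr.
rewrite /gain /=; have [->|ji] := eqVneq j imax.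
  by rewrite addn1/=; exact: hmax.
by rewrite addn0; apply: IH2; move: nj; rewrite (negbTE ji) addn0.
Qed.

Lemma chord_le_line (R : realType) (u : nat -> R) (c lam f : R) (n k : nat) :
  (forall l, u l <= u n + lam * (l%:R - n%:R)) -> 0 <= f -> f <= 1 ->
  (1 - f) * u k + f * u k.+1 <= u n + lam * (k%:R + f - n%:R).
Proof.
move=> h f0 f1; have hk := h k; have := h k.+1; rewrite -natr1 => hk1.
have : (1 - f) * u k <= (1 - f) * (u n + lam * (k%:R - n%:R)) by rewrite ler_wpM2l//; lra.
have : f * u k.+1 <= f * (u n + lam * (k%:R + 1 - n%:R)) by rewrite ler_wpM2l.
lra.
Qed.

(* The largest remaining gain is a multiplier for the constraint
   [\sum_i n i = N]. *)
Lemma greedy_ge_line (R : realType) (s : nat) (p x0 : R) (w : 'I_s -> R)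
    (N : nat) (n : 'I_s -> nat) :
  (0 < s)%N -> 0 <= p -> p <= 1 -> (forall i, 0 <= w i) ->
  \sum_i w i = N%:R -> (forall i j : 'I_s, (i <= j)%N -> w j <= w i) ->
  0 < x0 -> (2 - p) * x0 `^ (1 - p) <= 1 ->
  greedy_run p w N n ->
  s%:R * x0 `^ (2 - p) + (2 - p) * x0 `^ (1 - p) * (N%:R - s%:R * x0)
    <= \sum_i pow00 (n i)%:R p * pow00 (w i) (1 - p).
Proof.
move=> s0 p0 p1 w0 wN ws x00 sg run.
have [nN marg] := greedy_run_marginals s0 p0 p1 w0 ws run.
pose i1 := [arg max_(i > Ordinal s0) gain p w n i]%O.
have hi1 i : gain p w n i <= gain p w n i1.
  by rewrite /i1; case: Order.TotalTheory.arg_maxP => // j _ h; exact: h.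
set lam := gain p w n i1 in hi1.
have key i : x0 `^ (2 - p) + (2 - p) * x0 `^ (1 - p) * (w i - x0) <=
    pow00 (n i)%:R p * pow00 (w i) (1 - p) + lam * (w i - (n i)%:R).
  (* The chord through the two integers around w_i: above the tangent at x0, below the supporting
     line of slope [lam] at n_i. *)
  pose k := Num.truncn (w i); pose f := w i - k%:R.
  have /andP[k1 k2] := Num.Theory.truncn_itv (w0 i).
  have wE : w i = k%:R + f by rewrite /f; ring.
  have f0 : 0 <= f by rewrite subr_ge0.
  have f1 : f <= 1 by rewrite /f; move: k2; rewrite -natr1 -/k; lra.
  apply: le_trans (_ : pow00 (w i) (1 - p) * ((1 - f) * pow00 k%:R p + f * pow00 k.+1%:R p) <= _).
    by rewrite {1 2}wE; apply: chord_ge_line.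
  have := @chord_le_line R (fun l => pow00 l%:R p * pow00 (w i) (1 - p)) 0 lam f (n i) k.
  rewrite -wE => h; apply: le_trans (h _ f0 f1).
    by rewrite le_eqVlt; apply/orP; left; apply/eqP; ring.
  apply: concave_seq_le_line.
  - move=> a b ab; rewrite -!mulrBl; apply: ler_wpM2r; first exact: pow00_ge0.
    exact: pow00_increment_le.
  - by rewrite -mulrBl; exact: hi1.
  - move=> ni0; rewrite -mulrBl; have := marg i1 i ni0.
    by rewrite {2}/gain prednK.
(* After summation the multiplier terms cancel, since w and n both have total N. *)
have := ler_sum (index_enum 'I_s) (fun i (_ : true) => key i).
rewrite !big_split/= sumr_const card_ord -!mulr_sumr !sumrB wN -natr_sum nN sumr_const card_ord.
by rewrite subrr mulr0 addr0 -[x0 `^ _ *+ s]mulr_natl -[x0 *+ s]mulr_natl.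
Qed.

(** * The bound F *)

Lemma Fcond1 (R : realType) (N s : nat) : Fcond (1 : R) N s.
Proof. by rewrite /Fcond subrr powRr0 (_ : 2 - 1 = 1) ?invr1//; ring. Qed.

Lemma powR_split (R : realType) (x p : R) : 0 < x -> x `^ (2 - p) = x * x `^ (1 - p).
Proof.
move=> x0; rewrite (_ : 2 - p = 1 + (1 - p)); last by ring.
by rewrite powRD ?powRr1 ?(ltW x0)// (gt_eqF x0) implybT.
Qed.

Lemma Fbound_le (R : realType) (p S : R) (N s : nat) :
  0 <= p -> p <= 1 -> (0 < N)%N -> (0 < s)%N ->
  (forall x0, 0 < x0 -> (2 - p) * x0 `^ (1 - p) <= 1 ->
    s%:R * x0 `^ (2 - p) + (2 - p) * x0 `^ (1 - p) * (N%:R - s%:R * x0) <= S) ->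
  Fbound p N s <= S / N%:R.
Proof.
move=> p0 p1 N0 s0 h.
have n0 : 0 < N%:R :> R by rewrite ltr0n.
have s0' : 0 < s%:R :> R by rewrite ltr0n.
have q0 : 0 < 2 - p by lra.
rewrite ler_pdivlMr// /Fbound; case: ifPn => [cond|/negP cond].
  (* At x0 = N/s the linear term vanishes and the value s x0^(2-p) is N times the first branch;
     [Fcond] is the slope condition at x0. *)
  have x00 : 0 < N%:R / s%:R :> R by exact: divr_gt0.
  move: cond; rewrite /Fcond -[leRHS]div1r ler_pdivlMr// mulrC => c1.
  apply: le_trans (h _ x00 c1); rewrite /Fsmall powR_split//; set y := _ `^ _.
  by rewrite le_eqVlt; apply/orP; left; apply/eqP; field; rewrite gt_eqF.
have p1' : p < 1.
  rewrite lt_neqAle p1 andbT; apply/eqP => pE; apply: cond; rewrite pE; exact: Fcond1.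
have u0 : 1 - p != 0 by rewrite subr_eq0 gt_eqF.
(* The point where the tangent to x^(2-p) has slope exactly 1. *)
pose x0 := (2 - p)^-1 `^ (1 - p)^-1.
have x00 : 0 < x0 by rewrite powR_gt0// invr_gt0.
have xE : x0 `^ (1 - p) = (2 - p)^-1.
  by rewrite -powRrM mulVf// powRr1// invr_ge0 ltW.
have := h _ x00; rewrite xE divff ?gt_eqF// => /(_ (lexx _)).
rewrite /Flarge [_ / (1 - p)]mulrC powRrM -/x0 powR_split// xE.
apply: le_trans.
by rewrite le_eqVlt; apply/orP; left; apply/eqP; field; rewrite !gt_eqF.
Qed.

(** Reduces to e^(1-p) >= 1 + (1-p). *)
Lemma Fcond_small_ratio (R : realType) (p : R) (N s : nat) :
  p <= 1 -> N%:R / s%:R <= expR (- 1) :> R -> Fcond p N s.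
Proof.
move=> p1 h; rewrite /Fcond.
have q0 : 0 < 2 - p by lra.
apply: (@le_trans _ _ (expR (- 1) `^ (1 - p))).
  by apply: ge0_ler_powR; rewrite ?subr_ge0 ?nnegrE ?divr_ge0 ?expR_ge0.
rewrite -expRM mulN1r expRN lef_pV2 ?posrE ?expR_gt0//.
by have := expR_ge1Dx (1 - p); lra.
Qed.

Lemma inv_lt_half_powR (R : realType) (p : R) : 0 < p -> p < 1 ->
  (2 - p)^-1 < 2^-1 `^ (1 - p).
Proof.
move=> p0 p1; have q0 : 0 < 2 - p by lra.
have : 2 `^ (1 - p) < 2 - p.
  (* Bernoulli at 2 would give only a weak inequality. On the two factors, with u = 1 - p, it gives
     (1 + u/2) (1 + u/3), which falls short of 1 + u by u (1 - u) / 6 > 0. *)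
  rewrite (_ : 2 = 3 / 2 * (4 / 3) :> R); last by field.
  rewrite powRM; [|lra|lra].
  have h1 := @powR_le_tangent1 R (1 - p) (3 / 2).
  have h2 := @powR_le_tangent1 R (1 - p) (4 / 3).
  have {}h1 := h1 ltac:(lra) ltac:(lra) ltac:(lra).
  have {}h2 := h2 ltac:(lra) ltac:(lra) ltac:(lra).
  apply: le_lt_trans (_ : (1 + (1 - p) * (3 / 2 - 1)) * (1 + (1 - p) * (4 / 3 - 1)) < _).
    by apply: ler_pM => //; exact: powR_ge0.
  have : 0 < p * (1 - p) by rewrite mulr_gt0// subr_gt0.
  lra.
rewrite -[2^-1]powR_inv1// -powRrM mulN1r powRN ltf_pV2 ?posrE ?powR_gt0//.
Qed.

(** The disjunction excludes p = 0 with N/s = 1/2, where [Fcond] holds with equality. *)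
Lemma FcondN_large_ratio (R : realType) (p : R) (N s : nat) :
  0 <= p -> p < 1 -> 2^-1 <= N%:R / s%:R :> R ->
  0 < p \/ 2^-1 < N%:R / s%:R :> R -> ~~ Fcond p N s.
Proof.
move=> p0 p1 h; rewrite /Fcond -ltNge; have [->|pn0] := eqVneq p 0.
  by rewrite ltxx => -[//|]; rewrite !subr0 powRr1// divr_ge0.
move=> _; have pp : 0 < p by rewrite lt_neqAle eq_sym pn0.
apply: lt_le_trans (inv_lt_half_powR pp p1) _.
by apply: ge0_ler_powR; rewrite ?subr_ge0 ?(ltW p1) ?nnegrE ?divr_ge0 ?invr_ge0.
Qed.

(** In this range [Fcond] can hold only at p = 1 or at p = 0 with N/s = 1/2; there the two branches
    agree, with common value 1 and 1/2 respectively. *)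
Lemma Fbound_large_ratio (R : realType) (p : R) (N s : nat) :
  0 <= p -> p <= 1 -> 2^-1 <= N%:R / s%:R :> R ->
  Fbound p N s = Flarge p N s.
Proof.
move=> p0; rewrite le_eqVlt => /predU1P[-> _|p1 h].
  by rewrite /Fbound Fcond1 /Fsmall /Flarge subrr powRr0 mulr0 mul0r subr0.
rewrite /Fbound; case: ifPn => // cond.
have [pp|] := ltP 0 p; first by have := FcondN_large_ratio p0 p1 h (or_introl pp); rewrite cond.
move=> p0'; have pE : p = 0 by apply/eqP; rewrite eq_le p0'.
have hE : N%:R / s%:R = 2^-1 :> R.
  apply/eqP; rewrite eq_sym eq_le h leNgt; apply/negP => h'.
  by have := FcondN_large_ratio p0 p1 h (or_intror h'); rewrite cond.
rewrite pE /Fsmall /Flarge hE !subr0 powRr1// -(invf_div N%:R) hE mulr1 divr1.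
by rewrite powR_mulrn// expr2; field.
Qed.

(** * Power sums compared through logarithms *)

(** b ln (1 + z) = ln ((1 + z)^b) <= (1 + z)^b - 1 <= z^b, the last step by subadditivity of the
    power. *)
Lemma ln1D_le_powR (R : realType) (b z : R) : 0 < b -> b <= 1 -> 0 < z ->
  ln (1 + z) <= b^-1 * z `^ b.
Proof.
move=> b0 b1 z0; have y0 : 0 < 1 + z by lra.
have sub : (1 + z) `^ b <= 1 + z `^ b.
  have yb : 0 < (1 + z) `^ b by exact: powR_gt0.
  have h x : 0 < x -> x <= 1 + z -> x / (1 + z) * (1 + z) `^ b <= x `^ b.
    move=> x0 xz; have xy0 : 0 < x / (1 + z) by exact: divr_gt0.
    have -> : x `^ b = (x / (1 + z)) `^ b * (1 + z) `^ b.
      by rewrite -powRM ?(ltW xy0) ?(ltW y0)// divfK// gt_eqF.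
    by rewrite ler_wpM2r ?(ltW yb)// ger1_powR// xy0 ler_pdivrMr// mul1r.
  have h1 := h 1 ltr01; rewrite powR1 in h1.
  have := lerD (h1 _) (h z z0 _); rewrite -mulrDl -mulrDl divff ?gt_eqF// mul1r; apply; lra.
rewrite mulrC ler_pdivlMr// mulrC -ln_powR.
have := @le_ln1Dx R ((1 + z) `^ b - 1); rewrite subrKC => h.
apply: le_trans (h _) _; last by lra.
by rewrite ltrBrDl subrr powR_gt0.
Qed.

(** The integrand of the Mellin transform of ln (1 + u), u^(-p) ln (1 + u) du/u, after u = e^t;
    integrable over the line for 0 < p < 1. *)
Definition mellin_kernel (R : realType) (p t : R) : R :=
  expR (- (p * t)) * ln (1 + expR t).

Lemma mellin_kernel_gt0 (R : realType) (p t : R) : 0 < mellin_kernel p t.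
Proof. by rewrite mulr_gt0 ?expR_gt0// ln_gt0// ltrDl expR_gt0. Qed.

Lemma mellin_kernel_le_shift (R : realType) (p t t' : R) : t <= t' ->
  mellin_kernel p t <= expR (p * (t' - t)) * mellin_kernel p t'.
Proof.
move=> tt'; rewrite mulrA -expRD (_ : _ - p * t' = - (p * t)); last by ring.
by rewrite ler_wpM2l ?expR_ge0// ler_ln ?posrE ?addr_gt0 ?expR_gt0// lerD2l ler_expR.
Qed.

(** Controls both tails: b < p gives decay at +oo, b > p at -oo. *)
Lemma mellin_kernel_le (R : realType) (p b t : R) : 0 < b -> b <= 1 ->
  mellin_kernel p t <= b^-1 * expR ((b - p) * t).
Proof.
move=> b0 b1; have := ln1D_le_powR b0 b1 (expR_gt0 t).
rewrite -expRM -(ler_pM2l (expR_gt0 (- (p * t)))) => /le_trans; apply.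
by rewrite mulrCA -expRD (_ : - (p * t) + t * b = (b - p) * t)//; ring.
Qed.

Lemma cvgn_expR_linear (R : realType) (c d : R) : c < 0 ->
  (fun K : nat => expR (c * K%:R + d)) @ \oo --> (0 : R).
Proof.
move=> c0.
have -> : (fun K : nat => expR (c * K%:R + d)) = (fun K => expR d * expR c ^+ K).
  by apply/funext => K; rewrite expRD expRM_natr mulrC.
rewrite -(mulr0 (expR d)); apply: cvgMl_tmp; apply: cvg_expr.
by rewrite ger0_norm ?expR_ge0// expR_lt1.
Qed.

Lemma cvg_eqfun (R : realType) (u v : nat -> R) (l l' : R) :
  v @ \oo --> l -> l = l' -> u =1 v -> u @ \oo --> l'.
Proof. by move=> vl <- /funext ->. Qed.

Lemma mellin_kernel_cvg0 (R : realType) (p b c d : R) :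
  0 < b -> b <= 1 -> (b - p) * c < 0 ->
  (fun K : nat => mellin_kernel p (c * K%:R + d)) @ \oo --> (0 : R).
Proof.
move=> b0 b1 bc.
apply: (@squeeze_cvgr _ _ _ _ (fun=> 0) (fun K => b^-1 * expR ((b - p) * c * K%:R + (b - p) * d))).
- near=> K; rewrite (ltW (mellin_kernel_gt0 _ _))/=.
  by rewrite -mulrA -mulrDr; exact: mellin_kernel_le.
- exact: cvg_cst.
- by rewrite -[X in _ --> X](mulr0 b^-1); apply: cvgMl_tmp; exact: cvgn_expR_linear.
Unshelve. all: by end_near.
Qed.

Definition mellin_sum (R : realType) (p d : R) (K : nat) (a : R) : R :=
  \sum_(i < K.*2.+1) mellin_kernel p (d * (i%:R - K%:R + a)).

Lemma mellin_sum_step (R : realType) (p d : R) (K : nat) (a : R) :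
  mellin_sum p d K (a + 1) - mellin_sum p d K a =
  mellin_kernel p (d * K%:R + d * (a + 1)) - mellin_kernel p (- d * K%:R + d * a).
Proof.
rewrite /mellin_sum big_ord_recr [X in _ - X]big_ord_recl /=.
have -> : d * (0 - K%:R + a) = - d * K%:R + d * a by ring.
have -> : d * (K.*2%:R - K%:R + (a + 1)) = d * K%:R + d * (a + 1).
  by rewrite -addnn natrD; ring.
under [X in _ - (_ + X)]eq_bigr => i _.
  rewrite /bump /= natrD (_ : d * _ = d * (i%:R - K%:R + (a + 1))); last by ring.
  over.
by ring.
Qed.

(** A shift by one mesh step exchanges only the two end terms, which lie in the tails and vanish as
    K grows; an integer shift repeats this. *)
Lemma mellin_sum_shift_cvg0 (R : realType) (p d : R) (j : int) :
  0 < p -> p < 1 -> 0 < d ->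
  (fun K => mellin_sum p d K j%:~R - mellin_sum p d K 0) @ \oo --> (0 : R).
Proof.
move=> p0 p1 d0.
have step a : (fun K => mellin_sum p d K (a + 1) - mellin_sum p d K a) @ \oo --> (0 : R).
  have h1 : (fun K : nat => mellin_kernel p (d * K%:R + d * (a + 1))) @ \oo --> (0 : R).
    by apply: (@mellin_kernel_cvg0 _ _ (p / 2)); nra.
  have h2 : (fun K : nat => mellin_kernel p (- d * K%:R + d * a)) @ \oo --> (0 : R).
    by apply: (@mellin_kernel_cvg0 _ _ 1); nra.
  apply: (cvg_eqfun (cvgB h1 h2)); rewrite ?subr0// => K.
  by rewrite mellin_sum_step.
elim/int_rect: j => [|n IH|n IH].
- by under eq_fun do rewrite subrr; exact: cvg_cst.
- apply: (cvg_eqfun (cvgD (step n%:~R) IH)); rewrite ?addr0// => K.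
  rewrite fctE /= -addn1 PoszD intrD.
  by rewrite addrA subrK.
- apply: (cvg_eqfun (cvgB IH (step (- n.+1%:Z)%:~R))); rewrite ?subr0// => K.
  rewrite fctE /=.
  rewrite (_ : (- n.+1%:Z)%:~R + 1 = (- n%:Z)%:~R :> R); last first.
    by rewrite -addn1 PoszD !intrN intrD; ring.
  by rewrite opprB addrC addrA subrK.
Qed.

(** A shift by less than one mesh step costs a factor e^(pd), harmless once d tends to 0. *)
Lemma mellin_sum_le_shift (R : realType) (p d : R) (K : nat) (a b : R) :
  0 <= p -> 0 <= d -> a <= b -> b <= a + 1 ->
  mellin_sum p d K a <= expR (p * d) * mellin_sum p d K b.
Proof.
move=> p0 d0 ab ba; rewrite mulr_sumr; apply: ler_sum => i _.
set t := _ - K%:R.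
apply: (le_trans (@mellin_kernel_le_shift R p _ (d * (t + b)) _)).
  by rewrite ler_wpM2l// lerD2l.
rewrite ler_wpM2r ?(ltW (mellin_kernel_gt0 _ _))// ler_expR ler_wpM2l//.
rewrite -mulrBr -[leRHS]mulr1 ler_wpM2l//; lra.
Qed.

(* Riemann sum of mesh [d] over [-K d, K d] for
   [\int e^(-p t) ln (1 + e^t x) dt]; the translation t -> t - ln x shows that
   the full integral is proportional to [x^p]. *)
Definition mellin_log (R : realType) (p d : R) (K : nat) (x : R) : R :=
  \sum_(i < K.*2.+1)
    expR (- (p * (d * (i%:R - K%:R)))) * ln (1 + expR (d * (i%:R - K%:R)) * x).

Lemma mellin_log0 (R : realType) (p d : R) (K : nat) : mellin_log p d K 0 = 0.
Proof. by apply: big1 => i _; rewrite mulr0 addr0 ln1 mulr0. Qed.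

Lemma mellin_logE (R : realType) (p d x : R) (K : nat) : 0 < x -> d != 0 ->
  mellin_log p d K x = x `^ p * mellin_sum p d K (ln x / d).
Proof.
move=> x0 d0; rewrite mulr_sumr; apply: eq_bigr => i _.
have -> : d * (i%:R - K%:R + ln x / d) = d * (i%:R - K%:R) + ln x by field.
set t := d * _; rewrite /mellin_kernel [expR (t + _)]expRD lnK ?posrE// mulrA; congr (_ * _).
by rewrite /powR gt_eqF// -expRD; congr expR; ring.
Qed.

(** Round ln x / d up to an integer, at the cost of e^(pd); the integer shift then costs an error
    vanishing in K. Zero entries contribute nothing to either side. The lower bound rounds down
    instead. *)
Lemma mellin_log_upper (R : realType) (p d : R) (s : seq R) :
  0 < p -> p < 1 -> 0 < d -> all (Num.le 0) s ->
  exists2 e : nat -> R, e @ \oo --> (0 : R) &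
    forall K, \sum_(x <- s) mellin_log p d K x <=
      expR (p * d) * (\sum_(x <- s) x `^ p) * mellin_sum p d K 0 + e K.
Proof.
move=> p0 p1 d0; elim: s => [_|x s IH /= /andP[x0 /IH[e e0 he]]].
  by exists (fun=> 0); [exact: cvg_cst|move=> K; rewrite !big_nil mulr0 mul0r addr0].
move: x0; rewrite le_eqVlt => /predU1P[<-|x0].
  by exists e => // K; rewrite !big_cons mellin_log0 powR0 ?gt_eqF// !add0r.
pose j := (Num.floor (ln x / d) + 1)%R.
have /andP[j1 j2] := Num.Theory.floor_itv (ln x / d).
exists (fun K => x `^ p * expR (p * d) * (mellin_sum p d K j%:~R - mellin_sum p d K 0) + e K).
  have shift := mellin_sum_shift_cvg0 j p0 p1 d0.
  by apply: (cvg_eqfun (cvgD (cvgMl_tmp (a := x `^ p * expR (p * d)) shift) e0));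
    rewrite ?mulr0 ?addr0// => K.
move=> K; rewrite !big_cons mellin_logE ?gt_eqF//.
have h : mellin_sum p d K (ln x / d) <= expR (p * d) * mellin_sum p d K j%:~R.
  apply: mellin_sum_le_shift; [exact: ltW|exact: ltW|exact: ltW|].
  by rewrite /j intrD lerD2r.
have := he K; move: h; rewrite -(ler_pM2l (powR_gt0 p x0)); lra.
Qed.

Lemma mellin_log_lower (R : realType) (p d : R) (s : seq R) :
  0 < p -> p < 1 -> 0 < d -> all (Num.le 0) s ->
  exists2 e : nat -> R, e @ \oo --> (0 : R) &
    forall K, (\sum_(x <- s) x `^ p) * mellin_sum p d K 0 <=
      expR (p * d) * \sum_(x <- s) mellin_log p d K x + e K.
Proof.
move=> p0 p1 d0; elim: s => [_|x s IH /= /andP[x0 /IH[e e0 he]]].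
  by exists (fun=> 0); [exact: cvg_cst|move=> K; rewrite !big_nil mulr0 mul0r addr0].
move: x0; rewrite le_eqVlt => /predU1P[<-|x0].
  by exists e => // K; rewrite !big_cons mellin_log0 powR0 ?gt_eqF// !add0r.
pose j := Num.floor (ln x / d).
have /andP[j1 j2] := Num.Theory.floor_itv (ln x / d).
exists (fun K => - x `^ p * (mellin_sum p d K j%:~R - mellin_sum p d K 0) + e K).
  have shift := mellin_sum_shift_cvg0 j p0 p1 d0.
  by apply: (cvg_eqfun (cvgD (cvgMl_tmp (a := - x `^ p) shift) e0));
    rewrite ?mulr0 ?addr0// => K.
move=> K; rewrite !big_cons mellin_logE ?gt_eqF//.
have h : mellin_sum p d K j%:~R <= expR (p * d) * mellin_sum p d K (ln x / d).
  apply: mellin_sum_le_shift; [exact: ltW|exact: ltW|exact: j1|].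
  by move: j2; rewrite intrD => /ltW.
have := he K; move: h; rewrite -(ler_pM2l (powR_gt0 p x0)); lra.
Qed.

Lemma le_of_le_expR_mul (R : realType) (a b : R) : 0 <= a ->
  (forall e, 0 < e -> a <= expR e * b) -> a <= b.
Proof.
move=> a0 h; apply/ler_addgt0Pr => e e0.
have a1 : 0 < a + 1 by lra.
have := h _ (divr_gt0 e0 a1); rewrite -ler_pdivrMl ?expR_gt0// -expRN => h2.
have h3 : a * (e / (a + 1)) <= e.
  by rewrite mulrA ler_pdivrMr// mulrC ler_pM2l//; lra.
have := ler_wpM2l a0 (expR_ge1Dx (- (e / (a + 1)))).
lra.
Qed.

(** For p < 1, x^p is a positive mixture of the functions ln (1 + t x), realized by Riemann sums:
    first K tends to infinity, then d to 0. For p = 1 the mixture diverges, and x is recovered as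
    the limit of ln (1 + t x) / t at t = 0. *)
Lemma sum_powR_le_of_ln (R : realType) (p : R) (s1 s2 : seq R) :
  0 < p -> p <= 1 -> all (Num.le 0) s1 -> all (Num.le 0) s2 ->
  (forall t, 0 < t ->
    \sum_(x <- s1) ln (1 + t * x) <= \sum_(x <- s2) ln (1 + t * x)) ->
  \sum_(x <- s1) x `^ p <= \sum_(x <- s2) x `^ p.
Proof.
move=> p0; rewrite le_eqVlt => /predU1P[->|p1] s10 s20 hln.
  have sumE s : all (Num.le 0) s -> \sum_(x <- s) x `^ 1 = \sum_(x <- s) x :> R.
    by move=> /allP s0; apply: eq_big_seq => x /s0 x0; rewrite powRr1.
  rewrite !sumE//; apply/ler_addgt0Pr => e e0.
  have q0 : 0 <= \sum_(x <- s1) x ^+ 2 by apply: sumr_ge0 => x _; exact: sqr_ge0.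
  set Q := \sum_(x <- s1) x ^+ 2 in q0.
  have Q1 : 0 < Q + 1 by lra.
  (* From y - y^2 <= ln (1 + y) <= y, the error after division by t is t Q, which this choice keeps
     below e. *)
  pose t := e / (Q + 1); have t0 : 0 < t by exact: divr_gt0.
  have lower : t * \sum_(x <- s1) x - t ^+ 2 * Q <= \sum_(x <- s1) ln (1 + t * x).
    rewrite /Q !mulr_sumr -sumrB big_seq [leRHS]big_seq.
    apply: ler_sum => x /(allP s10) x0.
    have y0 : 0 <= t * x by rewrite mulr_ge0// ltW.
    rewrite -exprMn; set y := t * x in y0 *; have y1 : 0 < 1 + y by lra.
    have := @le_ln1Dx R ((1 + y)^-1 - 1); rewrite subrKC lnV ?posrE//.
    have -> : (1 + y)^-1 - 1 = - (y / (1 + y)) by field; rewrite gt_eqF.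
    have -> : y / (1 + y) = y - y ^+ 2 / (1 + y) by field; rewrite gt_eqF.
    have : y ^+ 2 / (1 + y) <= y ^+ 2.
      by rewrite ler_pdivrMr// ler_peMr ?sqr_ge0//; lra.
    have : y ^+ 2 / (1 + y) > y - 1.
      rewrite ltr_pdivlMr//; lra.
    move=> h1 h2 h; have := h ltac:(lra); lra.
  have upper : \sum_(x <- s2) ln (1 + t * x) <= t * \sum_(x <- s2) x.
    rewrite mulr_sumr big_seq [leRHS]big_seq; apply: ler_sum => x /(allP s20) x0.
    by apply: le_ln1Dx; have := mulr_ge0 (ltW t0) x0; lra.
  have := le_trans lower (le_trans (hln _ t0) upper).
  rewrite lerBlDr (_ : t * _ + _ = t * (\sum_(x <- s2) x + t * Q)); last by ring.
  rewrite ler_pM2l// => /le_trans; apply; rewrite lerD2l.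
  by rewrite /t mulrAC ler_pdivrMr// ler_pM2l//; lra.
apply: le_of_le_expR_mul => [|e e0]; first by apply: sumr_ge0 => x _; exact: powR_ge0.
(* The two roundings, one per list, together cost exactly the factor e^e. *)
pose d := e / (2 * p); have d0 : 0 < d by rewrite divr_gt0// mulr_gt0.
have [e1 e10 h1] := mellin_log_lower p0 p1 d0 s10.
have [e2 e20 h2] := mellin_log_upper p0 p1 d0 s20.
set A := \sum_(x <- s1) _ in h1 *; set B := \sum_(x <- s2) _ in h2 *.
have eE : expR e = expR (p * d) * expR (p * d).
  by rewrite -expRD; congr expR; rewrite /d; field; rewrite gt_eqF.
have key K : (A - expR e * B) * mellin_sum p d K 0 <= expR (p * d) * e2 K + e1 K.
  have mid : \sum_(x <- s1) mellin_log p d K x <= \sum_(x <- s2) mellin_log p d K x.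
    rewrite /mellin_log exchange_big [leRHS]exchange_big /=; apply: ler_sum => i _.
    by rewrite -!mulr_sumr ler_wpM2l ?expR_ge0// hln// expR_gt0.
  have := h1 K; have := ler_wpM2l (expR_ge0 (p * d)) (le_trans mid (h2 K)).
  rewrite eE; lra.
(* Otherwise the left side of [key] stays above a positive constant, given by the central node i =
   K, while the right side tends to 0. *)
rewrite leNgt; apply/negP => AB.
have D0 : 0 < A - expR e * B by lra.
have {}key K : (A - expR e * B) * mellin_kernel p 0 <= expR (p * d) * e2 K + e1 K.
  apply: le_trans (key K); rewrite ler_pM2l// /mellin_sum.
  have KK : (K < K.*2.+1)%N by rewrite ltnS -addnn leq_addr.
  rewrite (bigD1 (Ordinal KK))//= subrr addr0 mulr0 lerDl.
  by apply: sumr_ge0 => i _; rewrite ltW// mellin_kernel_gt0.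
have lim0 : (fun K => expR (p * d) * e2 K + e1 K) @ \oo --> (0 : R).
  by apply: (cvg_eqfun (cvgD (cvgMl_tmp (a := expR (p * d)) e20) e10));
    rewrite ?mulr0 ?addr0// => K.
have : (A - expR e * B) * mellin_kernel p 0 <= 0.
  rewrite -[leRHS](cvg_lim _ lim0)//; apply: limr_ge; first by apply/cvg_ex; exists 0.
  by apply: nearW => K; exact: key.
by rewrite leNgt mulr_gt0// mellin_kernel_gt0.
Qed.

(** * Positive semidefinite matrices *)

Section RealSymmetric.
Variable R : realType.
Local Notation toC := (real_complex R).

(** Split over the complex numbers. For a left eigenvector v of eigenvalue z, evaluating v A v^* in
    two ways gives z |v|^2 = conj(z) |v|^2, so each root is real. *)
Lemma sym_char_poly_split (m : nat) (A : 'M[R]_m) : A^T = A ->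
  exists s : seq R, char_poly A = \prod_(x <- s) ('X - x%:P).
Proof.
move=> Asym; pose AC := map_mx toC A.
have [r rE] : {r : seq R[i] |
    char_poly AC = lead_coef (char_poly AC) *: \prod_(z <- r) ('X - z%:P)}.
  exact: closed_field_poly_normal.
rewrite (monicP (char_poly_monic AC)) scale1r in rE.
have real_root z : z \in r -> (complex.Re z)%:C%C = z.
  move=> zr; apply/RRe_real.
  have /eigenvalueP[v vA v0] : eigenvalue AC z by rewrite eigenvalue_root_char rE root_prod_XsubC.
  pose vs := (map_mx Num.conj v)^T.
  have Avs : AC *m vs = Num.conj z *: vs.
    apply: trmx_inj; rewrite trmx_mul linearZ /= trmxK map_trmx Asym.
    have -> : map_mx toC A = map_mx Num.conj (map_mx toC A).
      by apply/matrixP => i j; rewrite !mxE conj_Creal// complex_real.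
    by rewrite -map_mxM vA map_mxZ.
  have : z *: (v *m vs) = Num.conj z *: (v *m vs).
    by rewrite scalemxAl -vA -mulmxA Avs scalemxAr.
  move/matrixP/(_ 0 0); rewrite mxE [X in _ = X -> _]mxE => /mulIf zz.
  rewrite CrealE; apply/eqP; rewrite -zz// mxE; apply: contraNneq v0 => /eqP.
  rewrite psumr_eq0 => [|i _]; last by rewrite !mxE mul_conjC_ge0.
  move=> /allP h; apply/eqP/rowP => i; rewrite mxE.
  by have := h i; rewrite mem_index_enum !mxE mul_conjC_eq0 => /(_ isT)/eqP.
exists (map (@complex.Re R) r); apply: (@map_poly_inj _ _ toC).
rewrite map_char_poly rE big_map rmorph_prod; apply: eq_big_seq => z zr.
by rewrite /= rmorphB /= map_polyX map_polyC /= real_root.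
Qed.

Lemma horner_char_poly (m : nat) (A : 'M[R]_m) (a : R) :
  (char_poly A).[a] = \det (a%:M - A).
Proof.
rewrite /char_poly -[LHS]/(horner_eval a _) -det_map_mx; congr (\det _).
apply/matrixP => i j; rewrite !mxE /= /horner_eval hornerD hornerN hornerC.
by rewrite hornerMn hornerX.
Qed.

Lemma det_1D_scale (m : nat) (A : 'M[R]_m) (s : seq R) (t : R) :
  char_poly A = \prod_(x <- s) ('X - x%:P) ->
  \det (1%:M + t *: A) = \prod_(x <- s) (1 + t * x).
Proof.
move=> As; have [->|t0] := eqVneq t 0.
  rewrite scale0r addr0 det1; apply/esym/big1_seq => x _.
  by rewrite mul0r addr0.
have sz : size s = m.
  by have := size_char_poly A; rewrite As size_prod_XsubC => -[].
(* The determinant becomes the characteristic polynomial evaluated at -1/t. *)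
have -> : 1%:M + t *: A = (- t) *: ((- t^-1)%:M - A).
  by rewrite scalerBr scale_scalar_mx mulrNN mulfV// scaleNr opprK.
rewrite detZ -horner_char_poly As horner_prod -{1}sz.
elim: (s) => [|x u IH]; first by rewrite !big_nil expr0 mulr1.
rewrite /= exprS !big_cons mulrACA IH hornerXsubC; congr (_ * _).
by field.
Qed.

Lemma det_char_poly_split (m : nat) (A : 'M[R]_m) (s : seq R) :
  char_poly A = \prod_(x <- s) ('X - x%:P) -> \det A = \prod_(x <- s) x.
Proof.
move=> As; have sz : size s = m.
  by have := size_char_poly A; rewrite As size_prod_XsubC => -[].
have := char_poly_det A; rewrite -horner_coef0 As horner_prod.
under eq_bigr do rewrite hornerXsubC sub0r -mulN1r.
rewrite big_split /= big_const_seq count_predT sz iter_mulr_1.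
by move/mulfI => ->//; rewrite signr_eq0.
Qed.

Definition qform (m : nat) (A : 'M[R]_m) (x y : 'cV[R]_m) : R :=
  (x^T *m A *m y) 0 0.

Lemma qform_sym (m : nat) (A : 'M[R]_m) (x y : 'cV[R]_m) :
  A^T = A -> qform A x y = qform A y x.
Proof.
move=> As; have E : x^T *m A *m y = (y^T *m A *m x)^T.
  by rewrite !trmx_mul trmxK As mulmxA.
by rewrite /qform E mxE.
Qed.

Lemma qformDM (m : nat) (A B : 'M[R]_m) (x y : 'cV[R]_m) :
  qform (A + B) x y = qform A x y + qform B x y.
Proof. by rewrite /qform mulmxDr mulmxDl mxE. Qed.

Lemma qformZM (m : nat) (c : R) (A : 'M[R]_m) (x y : 'cV[R]_m) :
  qform (c *: A) x y = c * qform A x y.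
Proof. by rewrite /qform -scalemxAr -scalemxAl mxE. Qed.

Lemma qformDl (m : nat) (A : 'M[R]_m) (x y z : 'cV[R]_m) :
  qform A (x + y) z = qform A x z + qform A y z.
Proof. by rewrite /qform linearD /= !mulmxDl mxE. Qed.

Lemma qformZl (m : nat) (c : R) (A : 'M[R]_m) (x y : 'cV[R]_m) :
  qform A (c *: x) y = c * qform A x y.
Proof. by rewrite /qform linearZ /= -!scalemxAl mxE. Qed.

Lemma qformDr (m : nat) (A : 'M[R]_m) (x y z : 'cV[R]_m) :
  qform A x (y + z) = qform A x y + qform A x z.
Proof. by rewrite /qform mulmxDr mxE. Qed.

Lemma qformZr (m : nat) (c : R) (A : 'M[R]_m) (x y : 'cV[R]_m) :
  qform A x (c *: y) = c * qform A x y.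
Proof. by rewrite /qform -scalemxAr mxE. Qed.

Lemma qform_rank1 (m : nat) (v x y : 'cV[R]_m) :
  qform (v *m v^T) x y = qform 1%:M x v * qform 1%:M v y.
Proof.
by rewrite /qform !mulmx1 mulmxA -mulmxA [LHS]mxE big_ord1.
Qed.

Lemma psd_qform (m : nat) (A : 'M[R]_m) x : psd A -> 0 <= qform A x x.
Proof. by move=> [_]; exact. Qed.

Lemma psd0 (m : nat) : psd (0 : 'M[R]_m).
Proof. by split=> [|x]; rewrite ?trmx0// mulmx0 mul0mx mxE. Qed.

Lemma psdD (m : nat) (A B : 'M[R]_m) : psd A -> psd B -> psd (A + B).
Proof.
move=> pA pB; split=> [|x]; first by rewrite linearD /= pA.1 pB.1.
by rewrite -[leRHS]/(qform _ x x) qformDM addr_ge0 ?psd_qform.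
Qed.

Lemma psdZ (m : nat) (c : R) (A : 'M[R]_m) : 0 <= c -> psd A -> psd (c *: A).
Proof.
move=> c0 pA; split=> [|x]; first by rewrite linearZ /= pA.1.
by rewrite -[leRHS]/(qform _ x x) qformZM mulr_ge0 ?psd_qform.
Qed.

Lemma psd_sum (I : Type) (r : seq I) (P : pred I) (m : nat) (F : I -> 'M[R]_m) :
  (forall i, P i -> psd (F i)) -> psd (\sum_(i <- r | P i) F i).
Proof. by move=> h; apply: big_ind => //; [exact: psd0|exact: psdD]. Qed.

Lemma qform1C (m : nat) (x y : 'cV[R]_m) : qform 1%:M x y = qform 1%:M y x.
Proof. by rewrite qform_sym// trmx1. Qed.

Lemma psd_rank1 (m : nat) (v : 'cV[R]_m) : psd (v *m v^T).
Proof.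
split=> [|x]; first by rewrite trmx_mul trmxK.
by rewrite -[leRHS]/(qform _ x x) qform_rank1 qform1C -expr2 sqr_ge0.
Qed.

Lemma psd1 (m : nat) : psd (1%:M : 'M[R]_m).
Proof.
split=> [|x]; first exact: trmx1.
rewrite mulmx1 mxE; apply: sumr_ge0 => i _.
by rewrite mxE -expr2 sqr_ge0.
Qed.

Lemma psd_cauchy_schwarz (m : nat) (A : 'M[R]_m) (x y : 'cV[R]_m) : psd A ->
  qform A x y ^+ 2 <= qform A x x * qform A y y.
Proof.
move=> pA; have key t : 0 <= qform A x x + 2 * t * qform A x y + t ^+ 2 * qform A y y.
  have := psd_qform (x + t *: y) pA.
  rewrite !(qformDl, qformDr, qformZl, qformZr) (qform_sym y x pA.1).
  by congr (0 <= _); ring.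
have qx := psd_qform x pA; have := psd_qform y pA.
rewrite le_eqVlt => /predU1P[y0|y0].
  rewrite -y0 mulr0 le_eqVlt; apply/orP; left; rewrite sqrf_eq0.
  apply/negPn/negP => b0.
  (* With a zero leading coefficient the polynomial in t is affine; at this t it equals -1. *)
  have := key (- (qform A x x + 1) / (2 * qform A x y)).
  rewrite -y0 mulr0 addr0.
  have -> : 2 * (- (qform A x x + 1) / (2 * qform A x y)) * qform A x y = - (qform A x x + 1).
    by field.
  lra.
(* The minimizer of the quadratic polynomial in t. *)
have := key (- qform A x y / qform A y y).
have -> : qform A x x + 2 * (- qform A x y / qform A y y) * qform A x y +
    (- qform A x y / qform A y y) ^+ 2 * qform A y y =
    (qform A x x * qform A y y - qform A x y ^+ 2) / qform A y y.
  by field; rewrite gt_eqF.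
by rewrite pmulr_lge0 ?invr_gt0// subr_ge0.
Qed.

Lemma psd_char_poly (m : nat) (A : 'M[R]_m) : psd A ->
  char_poly A = \prod_(x <- eigenvalues A) ('X - x%:P) /\
  all (Num.le 0) (eigenvalues A).
Proof.
move=> pA; have E : char_poly A = \prod_(x <- eigenvalues A) ('X - x%:P).
  exact: (xgetPex [::] (sym_char_poly_split pA.1)).
split=> //; apply/allP => x xs.
have /eigenvalueP[v vA v0] : eigenvalue A x.
  by rewrite eigenvalue_root_char E root_prod_XsubC.
have := psd_qform v^T pA; rewrite /qform trmxK vA -scalemxAl mxE.
have vv : 0 < (v *m v^T) 0 0.
  have := psd_qform v^T (psd1 m); rewrite /qform trmxK mulmx1 le_eqVlt => /predU1P[|//].
  move=> /esym; rewrite mxE => /eqP; rewrite psumr_eq0; last first.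
    by move=> i _; rewrite mxE -expr2 sqr_ge0.
  move=> /allP h; case/negP: v0; apply/eqP/rowP => i.
  by have := h i; rewrite mem_index_enum !mxE -expr2 sqrf_eq0 => /(_ isT)/eqP.
by rewrite pmulr_lge0.
Qed.

Lemma psd_det_ge0 (m : nat) (A : 'M[R]_m) : psd A -> 0 <= \det A.
Proof.
move=> /psd_char_poly[E /allP h]; rewrite (det_char_poly_split E) big_seq.
by apply: prodr_ge0 => x /h.
Qed.

End RealSymmetric.

(** * Determinants and ranks of positive semidefinite matrices under rank-one updates *)

Section Determinants.
Variable R : realType.

(** The block products [B *m L] and [L *m B] have the same determinant; each is block triangular and
    displays one side. *)
Lemma det_1D_rank1 (m : nat) (u : 'cV[R]_m) (v : 'rV[R]_m) :
  \det (1%:M + u *m v) = 1 + (v *m u) 0 0.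
Proof.
pose B := block_mx 1%:M u (- v) (1%:M : 'M[R]_1).
pose L := block_mx 1%:M (- u) 0 (1%:M : 'M[R]_1).
have dL : \det L = 1 by rewrite det_ublock !det1 mulr1.
have BL : \det (B *m L) = 1 + (v *m u) 0 0.
  rewrite mulmx_block !mulmx1 !mul1mx !mulmx0 !addr0 addNr det_lblock.
  by rewrite det1 mul1r det_mx11 mulNmx mulmxN opprK addrC mxE [X in X + _]mxE eqxx.
have LB : \det (L *m B) = \det (1%:M + u *m v).
  rewrite mulmx_block !mulmx1 !mul1mx !mul0mx !add0r mulNmx mulmxN opprK.
  by rewrite subrr det_lblock det1 mulr1.
by rewrite -LB -BL !det_mulmx mulrC.
Qed.

Definition inv_form (m : nat) (A : 'M[R]_m) (v : 'cV[R]_m) : R :=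
  qform (invmx A) v v.

Lemma det_add_rank1 (m : nat) (A : 'M[R]_m) (v : 'cV[R]_m) (c : R) :
  A \in unitmx ->
  \det (A + c *: (v *m v^T)) = \det A * (1 + c * inv_form A v).
Proof.
move=> Au.
have -> : A + c *: (v *m v^T) = A *m (1%:M + (invmx A *m v) *m (c *: v^T)).
  by rewrite mulmxDr mulmx1 !mulmxA mulmxV// mul1mx -scalemxAr.
by rewrite det_mulmx det_1D_rank1 -scalemxAl mxE mulmxA.
Qed.

Lemma inv_formE (m : nat) (A : 'M[R]_m) (v : 'cV[R]_m) :
  A^T = A -> A \in unitmx ->
  inv_form A v = qform A (invmx A *m v) (invmx A *m v).
Proof.
move=> As Au; rewrite /inv_form /qform trmx_mul trmx_inv As.
by rewrite !mulmxA mulmxKV.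
Qed.

Lemma inv_form_ge0 (m : nat) (A : 'M[R]_m) (v : 'cV[R]_m) :
  psd A -> A \in unitmx -> 0 <= inv_form A v.
Proof. by move=> pA Au; rewrite inv_formE ?psd_qform// pA.1. Qed.

(** With x = A^-1 v and y = (A + D)^-1 v, the difference of the two sides is (x - y)^T A (x - y) +
    y^T D y. *)
Lemma inv_form_antitone (m : nat) (A D : 'M[R]_m) (v : 'cV[R]_m) :
  psd A -> psd D -> A \in unitmx -> A + D \in unitmx ->
  inv_form (A + D) v <= inv_form A v.
Proof.
move=> pA pD Au Bu; set x := invmx A *m v; set y := invmx (A + D) *m v.
have pB := psdD pA pD.
have yB : inv_form (A + D) v = qform (A + D) y y by rewrite inv_formE// pB.1.
have xA : inv_form A v = qform A x x by rewrite inv_formE// pA.1.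
have yx : qform A y x = inv_form (A + D) v.
  by rewrite /qform /x mulmxA mulmxK// /y trmx_mul trmx_inv pB.1.
have := psd_qform (x - y) pA; have := psd_qform y pD.
rewrite -scaleN1r !(qformDl, qformDr, qformZl, qformZr) (qform_sym x y pA.1).
rewrite yx -xA; move: yB; rewrite qformDM; lra.
Qed.

(** One step of a Cholesky elimination: subtracting (C x)(C x)^T / (x^T C x) leaves a psd matrix by
    Cauchy-Schwarz, and puts x in its kernel, so the rank drops. *)
Lemma psd_rank1_decomposition (m : nat) (C : 'M[R]_m) : psd C ->
  exists2 s : seq 'cV[R]_m, (size s <= \rank C)%N & C = \sum_(v <- s) v *m v^T.
Proof.
have [n] := ubnP (\rank C); elim: n C => // n IH C; rewrite ltnS => Cn pC.
have [C0|C0] := eqVneq C 0.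
  by exists [::]; rewrite ?C0 ?mxrank0// big_nil.
have [x x0] : exists x, 0 < qform C x x.
  apply: contrapT => h; move/eqP: C0; apply; apply/matrixP => i j.
  have qe k : qform C (delta_mx k 0) (delta_mx k 0) = 0.
    apply/eqP; rewrite eq_le psd_qform// andbT leNgt; apply/negP => hk.
    by apply: h; exists (delta_mx k 0).
  have := psd_cauchy_schwarz (delta_mx i 0) (delta_mx j 0) pC.
  rewrite qe mul0r => cs.
  have : qform C (delta_mx i 0) (delta_mx j 0) = 0.
    by apply/eqP; rewrite -sqrf_eq0 eq_le cs sqr_ge0.
  by rewrite /qform trmx_delta -rowE -colE !mxE.
set c := qform C x x in x0.
pose v := (Num.sqrt c)^-1 *: (C *m x).
have vv : v *m v^T = c^-1 *: ((C *m x) *m (C *m x)^T).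
  rewrite /v linearZ /= -scalemxAl -scalemxAr scalerA -invfM -expr2 sqr_sqrtr// ltW//.
have CxT : (C *m x)^T = x^T *m C by rewrite trmx_mul pC.1.
pose C' := C - v *m v^T.
have pC' : psd C'.
  split=> [|y]; first by rewrite /C' linearB /= pC.1 trmx_mul trmxK.
  rewrite -[leRHS]/(qform C' y y) /C' vv -scaleNr qformDM qformZM CxT.
  have -> : qform (C *m x *m (x^T *m C)) y y = qform C y x ^+ 2.
    rewrite expr2 {2}(qform_sym y x pC.1) /qform.
    have -> : y^T *m (C *m x *m (x^T *m C)) *m y = (y^T *m C *m x) *m (x^T *m C *m y).
      by rewrite !mulmxA.
    by rewrite mxE big_ord1.
  have := psd_cauchy_schwarz y x pC; rewrite -/c => cs.
  have : qform C y x ^+ 2 / c <= qform C y y by rewrite ler_pdivrMr.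
  lra.
have lt : (C' < C)%MS.
  rewrite ltmxE; apply/andP; split.
    rewrite /C' vv CxT mulmxA scalemxAl -{1}(mul1mx C) -mulmxBl; exact: submxMl.
  apply/negP => /submxP[D CD].
  have C'x : C' *m x = 0.
    rewrite /C' vv mulmxBl CxT -scalemxAl -(mulmxA (C *m x)).
    have -> : x^T *m C *m x = c%:M by rewrite [LHS]mx11_scalar.
    by rewrite mul_mx_scalar scalerA mulVf ?gt_eqF// scale1r subrr.
  by move: x0; rewrite /c /qform -mulmxA CD -mulmxA C'x !mulmx0 mxE ltxx.
have lt' := rank_ltmx lt.
have [s sz sE] := IH C' (leq_trans lt' Cn) pC'.
exists (v :: s); first exact: leq_ltn_trans lt'.
by rewrite big_cons -sE /C' subrKC.
Qed.

Lemma det_le_add_psd (m : nat) (A D : 'M[R]_m) : psd A -> psd D ->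
  \det A <= \det (A + D).
Proof.
move=> pA /psd_rank1_decomposition[s _ ->].
elim: s A pA => [|v s IH] A pA; first by rewrite big_nil addr0.
rewrite big_cons addrA; apply: le_trans (IH _ (psdD pA (psd_rank1 v))).
have [Au|] := boolP (A \in unitmx).
  rewrite -(scale1r (v *m v^T)) det_add_rank1// ler_peMr ?psd_det_ge0//.
  by rewrite mul1r lerDl inv_form_ge0.
rewrite unitmxE unitfE negbK => /eqP ->.
exact: psd_det_ge0 (psdD pA (psd_rank1 v)).
Qed.

Lemma psd_unitE (m : nat) (A : 'M[R]_m) : psd A ->
  (A \in unitmx) = (0 < \det A).
Proof. by move=> /psd_det_ge0 h; rewrite unitmxE unitfE lt_neqAle eq_sym h andbT. Qed.

Lemma psd_unitD (m : nat) (A D : 'M[R]_m) : psd A -> psd D ->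
  A \in unitmx -> A + D \in unitmx.
Proof.
move=> pA pD; rewrite !psd_unitE//; last exact: psdD.
by move=> /lt_le_trans; apply; exact: det_le_add_psd.
Qed.

(** Diminishing returns of ln det, stated multiplicatively. C is added one rank-one term at a time;
    a single term is [inv_form_antitone], and consecutive terms chain after cancelling the positive
    intermediate determinant. *)
Lemma det_submodular (m : nat) (A D C : 'M[R]_m) :
  psd A -> psd D -> psd C -> A \in unitmx ->
  \det (A + D + C) * \det A <= \det (A + C) * \det (A + D).
Proof.
move=> pA pD /psd_rank1_decomposition[s _ ->].
elim: s A pA => [|v s IH] A pA Au; first by rewrite big_nil !addr0 mulrC.
rewrite big_cons; set T := \sum_(_ <- _) _.
have pv := psd_rank1 v; have pAv := psdD pA pv.
have step : \det (A + v *m v^T + D) * \det A <= \det (A + v *m v^T) * \det (A + D).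
  have ADu := psd_unitD pA pD Au.
  rewrite (addrAC A) -(scale1r (v *m v^T)) !det_add_rank1// !mul1r mulrAC.
  rewrite (mulrC (\det (A + D))) [leRHS]mulrAC ler_wpM2l//.
    by rewrite mulr_ge0 ?psd_det_ge0//; exact: psdD.
  by rewrite lerD2l inv_form_antitone.
have Avu := psd_unitD pA pv Au.
have := IH _ pAv Avu; rewrite -/T -(addrAC _ D) !addrA.
rewrite psd_unitE// in Avu; rewrite psd_unitE// in Au => ih.
rewrite -(ler_pM2r Avu); have pT : psd T by apply: psd_sum => w _; exact: psd_rank1.
have d1 : 0 <= \det (A + v *m v^T + T) by apply: psd_det_ge0; exact: psdD.
have := ler_wpM2r (ltW Au) ih; have := ler_wpM2l d1 step.
rewrite (addrAC A (v *m v^T) D); nra.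
Qed.

(** With B = A + v v^T and a = v^T B^-1 v, the right side is det B (1 - (1 - c) a), so a <= 1
    suffices. *)
Lemma det_scale_rank1 (m : nat) (A : 'M[R]_m) (v : 'cV[R]_m) (c : R) :
  psd A -> 0 <= c -> c <= 1 ->
  c * \det (A + v *m v^T) <= \det (A + c *: (v *m v^T)).
Proof.
move=> pA c0 c1; have pv := psd_rank1 v.
have [Bu|] := boolP (A + v *m v^T \in unitmx); last first.
  rewrite unitmxE unitfE negbK => /eqP ->; rewrite mulr0; apply: psd_det_ge0.
  by apply: psdD => //; exact: psdZ.
have pB := psdD pA pv.
have -> : A + c *: (v *m v^T) = A + v *m v^T + (c - 1) *: (v *m v^T).
  by rewrite scalerBl scale1r addrA addrAC addrK.
rewrite det_add_rank1// mulrC ler_wpM2l ?psd_det_ge0//.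
set a := inv_form _ _.
have a0 : 0 <= a by exact: inv_form_ge0.
(* For x = B^-1 v, a = x^T B x = x^T A x + a^2. *)
have a1 : a ^+ 2 <= a.
  rewrite {2}/a inv_formE ?pB.1//; set x := invmx _ *m v.
  rewrite qformDM qform_rank1.
  have -> : qform 1%:M x v = a.
    by rewrite qform1C /qform mulmx1 /x mulmxA.
  have -> : qform 1%:M v x = a by rewrite /qform mulmx1 /x mulmxA.
  by rewrite -expr2 lerDr psd_qform.
have : a <= 1 by rewrite leNgt; apply/negP => a2; move: a1; rewrite expr2; nra.
nra.
Qed.

(** V splits into at most rank V rank-one terms, and scaling each costs at most a factor c. *)
Lemma det_scale_rank (m : nat) (W V : 'M[R]_m) (c : R) :
  psd W -> psd V -> 0 <= c -> c <= 1 ->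
  c ^+ \rank V * \det (W + V) <= \det (W + c *: V).
Proof.
move=> pW pV c0 c1; have [s sz VE] := psd_rank1_decomposition pV.
apply: (@le_trans _ _ (c ^+ size s * \det (W + V))).
  by rewrite ler_wpM2r ?ler_wiXn2l// psd_det_ge0//; exact: psdD.
rewrite VE; elim: s W pW {sz VE} => [|v s IH] W pW.
  by rewrite !big_nil scaler0 !addr0 mul1r.
rewrite big_cons /= scalerDr; set T := \sum_(_ <- _) _.
have pT : psd T by apply: psd_sum => w _; exact: psd_rank1.
rewrite [leRHS](_ : _ = \det (W + c *: T + c *: (v *m v^T))); last first.
  by congr (\det _); rewrite -addrA [c *: T + _]addrC.
apply: le_trans (det_scale_rank1 _ _ c0 c1); last exact/psdD/psdZ.
rewrite exprS -mulrA ler_wpM2l// -addrAC addrA.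
apply: IH; exact/psdD/psd_rank1.
Qed.

(* [\rank] reads its argument as a row space, whose sum is not the matrix sum. *)
Lemma rank_psd_sub (m : nat) (C D : 'M[R]_m) : psd C -> psd D ->
  (\rank C <= \rank (C + D)%R)%N.
Proof.
move=> pC pD; set K := kermx (C + D).
(* The kernel of C + D lies in that of C: x^T (C + D) x = 0 forces x^T C x = 0, hence x^T C = 0 by
   Cauchy-Schwarz. *)
have K0 : K *m C = 0.
  apply/row_matrixP => i; rewrite row_mul row0.
  set x := (row i K)^T.
  have h : qform (C + D) x x = 0.
    by rewrite /qform /x trmxK -row_mul mulmx_ker row0 mul0mx mxE.
  have x0 : qform C x x = 0.
    apply/eqP; rewrite eq_le psd_qform// andbT.
    by have := psd_qform x pD; move: h; rewrite qformDM; lra.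
  apply/rowP => j; rewrite [RHS]mxE.
  have -> : (row i K *m C) 0 j = qform C x (delta_mx j 0).
    by rewrite /qform /x trmxK -colE [RHS]mxE.
  apply/eqP; rewrite -sqrf_eq0 eq_le sqr_ge0 andbT.
  by rewrite (le_trans (psd_cauchy_schwarz _ _ pC))// x0 mul0r.
have := rank_leq_row (C + D); have := mulmx0_rank_max K0.
rewrite mxrank_ker; move: (\rank C) (\rank (C + D)%R) => a b h bm.
by rewrite -(leq_add2l (m - b)) subnK.
Qed.

End Determinants.

(** * Trace powers *)

Section TracePower.
Variables (R : realType) (m : nat) (p : R).
Hypotheses (p_gt0 : 0 < p) (p_le1 : p <= 1).

Lemma trace_powE (A : 'M[R]_m) :
  trace_pow p A = \sum_(x <- eigenvalues A) x `^ p.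
Proof. by rewrite /trace_pow gt_eqF. Qed.

Lemma trace_pow_ge0 (A : 'M[R]_m) : 0 <= trace_pow p A.
Proof. by rewrite trace_powE; apply: sumr_ge0 => x _; exact: powR_ge0. Qed.

Lemma sum_ln_eigenvalues (A : 'M[R]_m) (t : R) : psd A -> 0 < t ->
  \sum_(x <- eigenvalues A) ln (1 + t * x) = ln (\det (1%:M + t *: A)).
Proof.
move=> /psd_char_poly[E all0] t0; rewrite (det_1D_scale t E).
elim: (eigenvalues A) all0 => [|x s IH] /=; first by rewrite !big_nil ln1.
move=> /andP[x0 s0]; rewrite !big_cons IH// lnM// posrE.
  by rewrite ltr_wpDr// mulr_ge0// ltW.
rewrite big_seq; apply: prodr_gt0 => y /(allP s0) y0.
by rewrite ltr_wpDr// mulr_ge0// ltW.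
Qed.

Lemma psd_1D_scale (A : 'M[R]_m) (t : R) : psd A -> 0 < t ->
  psd (1%:M + t *: A) /\ 0 < \det (1%:M + t *: A).
Proof.
move=> pA t0; have ptA := psdZ (ltW t0) pA; have p1 := @psd1 R m.
split; first exact: psdD.
by rewrite (lt_le_trans _ (det_le_add_psd p1 ptA))// det1.
Qed.

(** Concatenating the eigenvalue lists on each side turns the claim into a comparison of sums of ln
    (1 + t x), which is [det_submodular] for 1 + t A. *)
Lemma trace_pow_submodular (A D C : 'M[R]_m) : psd A -> psd D -> psd C ->
  trace_pow p (A + D + C) + trace_pow p A <=
  trace_pow p (A + C) + trace_pow p (A + D).
Proof.
move=> pA pD pC; rewrite !trace_powE -!big_cat /=.
have nonneg (B : 'M[R]_m) : psd B -> all (Num.le 0) (eigenvalues B).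
  by move=> /psd_char_poly[].
have pAD := psdD pA pD; have pAC := psdD pA pC; have pADC := psdD pAD pC.
apply: (sum_powR_le_of_ln p_gt0 p_le1) => [||t t0].
- by rewrite all_cat (nonneg _ pADC) (nonneg _ pA).
- by rewrite all_cat (nonneg _ pAC) (nonneg _ pAD).
rewrite !big_cat /= (sum_ln_eigenvalues pADC t0) (sum_ln_eigenvalues pA t0).
rewrite (sum_ln_eigenvalues pAC t0) (sum_ln_eigenvalues pAD t0).
have [pA1 dA] := psd_1D_scale pA t0; have [_ dAD] := psd_1D_scale pAD t0.
have [_ dAC] := psd_1D_scale pAC t0; have [_ dADC] := psd_1D_scale pADC t0.
rewrite -!lnM ?posrE// ler_ln ?posrE ?mulr_gt0// !scalerDr !addrA.
apply: det_submodular => //; [exact: psdZ (ltW t0) _|exact: psdZ (ltW t0) _|].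
by rewrite psd_unitE.
Qed.

Lemma trace_pow_le_add (A D : 'M[R]_m) : psd A -> psd D ->
  trace_pow p A <= trace_pow p (A + D).
Proof.
move=> pA pD; rewrite !trace_powE; have pAD := psdD pA pD.
have [_ hA] := psd_char_poly pA; have [_ hAD] := psd_char_poly pAD.
apply: (sum_powR_le_of_ln p_gt0 p_le1 hA hAD) => t t0.
rewrite (sum_ln_eigenvalues pA t0) (sum_ln_eigenvalues pAD t0).
have [pA1 dA] := psd_1D_scale pA t0; have [_ dAD] := psd_1D_scale pAD t0.
rewrite ler_ln ?posrE// scalerDr addrA; apply: det_le_add_psd => //.
exact: psdZ (ltW t0) _.
Qed.

(** The eigenvalue lists need not be matched entry by entry: their sums of ln (1 + t x) agree for
    all t > 0, so the power comparison applies in both directions. *)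
Lemma trace_powZ (A : 'M[R]_m) (c : R) : psd A -> 0 <= c ->
  trace_pow p (c *: A) = c `^ p * trace_pow p A.
Proof.
move=> pA c0; rewrite !trace_powE mulr_sumr; have pcA := psdZ c0 pA.
have [_ hA] := psd_char_poly pA; have [_ hcA] := psd_char_poly pcA.
have -> : \sum_(x <- eigenvalues A) c `^ p * x `^ p =
    \sum_(x <- [seq c * x | x <- eigenvalues A]) x `^ p.
  rewrite big_map; apply: eq_big_seq => x /(allP hA) x0.
  by rewrite powRM.
have lnE t : 0 < t -> \sum_(x <- eigenvalues (c *: A)) ln (1 + t * x) =
    \sum_(x <- [seq c * x | x <- eigenvalues A]) ln (1 + t * x).
  move=> t0; rewrite sum_ln_eigenvalues// big_map.
  under eq_bigr do rewrite mulrA.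
  move: c0; rewrite le_eqVlt => /predU1P[<-|c0].
    rewrite scale0r scaler0 addr0 det1 ln1; apply/esym/big1 => x _.
    by rewrite mulr0 mul0r addr0 ln1.
  by rewrite sum_ln_eigenvalues ?mulr_gt0// scalerA.
have nonneg : all (Num.le 0) [seq c * x | x <- eigenvalues A].
  by rewrite all_map; apply: sub_all hA => x /= x0; rewrite mulr_ge0.
by apply/eqP; rewrite eq_le; apply/andP; split; apply: sum_powR_le_of_ln => // t t0;
  rewrite lnE.
Qed.

Lemma trace_pow_gt0 (A : 'M[R]_m) : (0 < m)%N -> psd A -> A \in unitmx ->
  0 < trace_pow p A.
Proof.
move=> m0 pA; rewrite psd_unitE// trace_powE; have [E all0] := psd_char_poly pA.
have := size_char_poly A; rewrite {1}E size_prod_XsubC => -[sz].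
rewrite (det_char_poly_split E); have {}m0 : (0 < size (eigenvalues A))%N by rewrite sz.
case: (eigenvalues A) all0 m0 => [//|x s] /= /andP[x0 s0] _.
rewrite !big_cons => d0; rewrite ltr_pwDl ?sumr_ge0// => [|y _]; last exact: powR_ge0.
rewrite powR_gt0// lt_neqAle x0 andbT eq_sym; apply/eqP => xE.
by rewrite xE mul0r ltxx in d0.
Qed.

End TracePower.

(** * The path bound for p > 0 *)

Section SubmodularPath.
Variables (R : realType) (s : nat) (N p : R) (g : ('I_s -> R) -> R).
Variables (w n : 'I_s -> R).
Hypotheses (p_gt0 : 0 < p) (p_le1 : p <= 1) (N_gt0 : 0 < N).
Hypotheses (w_ge0 : forall i, 0 <= w i) (w_sum : \sum_i w i = N).
Hypothesis n_ge0 : forall i, 0 <= n i.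
Hypothesis g_submod : forall y d h : 'I_s -> R,
  (forall i, 0 <= y i) -> (forall i, 0 <= d i) -> (forall i, 0 <= h i) ->
  g (fun i => y i + d i + h i) + g y <=
  g (fun i => y i + h i) + g (fun i => y i + d i).
Hypothesis g_le_add : forall y d : 'I_s -> R,
  (forall i, 0 <= y i) -> (forall i, 0 <= d i) -> g y <= g (fun i => y i + d i).
Hypothesis g_scale : forall (c : R) (y : 'I_s -> R),
  0 <= c -> (forall i, 0 <= y i) -> g (fun i => c * y i) = c `^ p * g y.
Hypothesis g_max : forall y : 'I_s -> R,
  (forall i, 0 <= y i) -> \sum_i y i <= N -> g y <= g w.

Lemma path_g0 (y : 'I_s -> R) : (forall i, y i = 0) -> g y = 0.
Proof.
move=> y0; have := g_scale (lexx 0) w_ge0; rewrite powR0 ?gt_eqF// mul0r => <-.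
by congr g; apply/funext => i; rewrite y0 mul0r.
Qed.

Lemma path_gw_ge0 : 0 <= g w.
Proof.
rewrite -(@path_g0 (fun=> 0))//; apply: g_max => //.
by rewrite big1// ltW.
Qed.

(* The gain of [h] at [y] is at least its gain at [r w - h], a point of total
   weight [r N - \sum h], where maximality of [w] and homogeneity bound [g]. *)
Lemma path_step (r : R) (y h : 'I_s -> R) : 0 < r ->
  (forall i, 0 <= y i) -> (forall i, 0 <= h i) ->
  (forall i, y i + h i <= r * w i) ->
  g w / N * (p * r `^ (p - 1) * \sum_i h i) <= g (fun i => y i + h i) - g y.
Proof.
move=> r0 y0 h0 yh; pose d i := r * w i - h i - y i.
have d0 i : 0 <= d i by rewrite /d -addrA -opprD [h i + _]addrC subr_ge0.
have := g_submod y0 d0 h0.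
have -> : (fun i => y i + d i + h i) = (fun i => r * w i).
  by apply/funext => i; rewrite /d; ring.
pose b := (\sum_i h i) / N.
have sE : \sum_i (y i + d i) = (r - b) * N.
  under eq_bigr => i _ do rewrite /d addrC subrK.
  by rewrite sumrB -mulr_sumr w_sum mulrBl /b divfK// gt_eqF.
have yd0 i : 0 <= y i + d i by rewrite addr_ge0.
have b0 : 0 <= b by rewrite divr_ge0 ?(ltW N_gt0)// sumr_ge0.
have rb0 : 0 <= r - b by rewrite -(pmulr_lge0 _ N_gt0) -sE sumr_ge0.
have ub : g (fun i => y i + d i) <= (r - b) `^ p * g w.
  move: rb0; rewrite le_eqVlt => /predU1P[rb0|rb0].
    rewrite path_g0 ?mulr_ge0 ?powR_ge0 ?path_gw_ge0// => i.
    have /eqP := sE; rewrite -rb0 mul0r psumr_eq0// => /allP/(_ i).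
    by rewrite mem_index_enum => /(_ isT)/eqP.
  have -> : (fun i => y i + d i) = (fun i => (r - b) * ((r - b)^-1 * (y i + d i))).
    by apply/funext => i; rewrite mulrA mulfV ?gt_eqF// mul1r.
  have ny0 i : 0 <= (r - b)^-1 * (y i + d i) by rewrite mulr_ge0// invr_ge0 ltW.
  rewrite g_scale ?(ltW rb0)// ler_wpM2l ?powR_ge0// g_max//.
  by rewrite -mulr_sumr sE mulrA mulVf ?gt_eqF// mul1r.
(* The tangent at r bounds r^p - (r - b)^p below by p r^(p-1) b. *)
have := powR_le_tangent (ltW p_gt0) p_le1 r0 rb0.
move/(ler_wpM2r path_gw_ge0); rewrite g_scale ?(ltW r0)//.
have -> : g w / N * (p * r `^ (p - 1) * \sum_i h i) = p * r `^ (p - 1) * b * g w.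
  by rewrite /b; field; rewrite gt_eqF.
lra.
Qed.

(* The path from 0 to [n] at time [k dt]; [potential] is shifted by [dt * w i]
   so that its increments lie below the tangents at the end of each step. *)
Let point (dt : R) (k : nat) (i : 'I_s) : R := Order.min (n i) (k%:R * dt * w i).

Let potential (dt : R) (k : nat) : R :=
  \sum_i pow00 (w i) (1 - p) * (point dt k i + dt * w i) `^ p.

(** Coordinatewise comparison with [path_step]. A coordinate that has reached n_i leaves the
    potential unchanged; otherwise its shifted position is r w_i, and the tangent there has slope p
    (r w_i)^(p-1), whose w_i-power is cancelled by the weight. *)
Lemma path_point_step (dt : R) (k : nat) : 0 < dt ->
  g w / N * (potential dt k.+1 - potential dt k) <=
  g (point dt k.+1) - g (point dt k).
Proof.
move=> dt0; set r := k.+1%:R * dt; have r0 : 0 < r by rewrite mulr_gt0.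
have rE : r = k%:R * dt + dt by rewrite /r -natr1 mulrDl mul1r.
pose h i := point dt k.+1 i - point dt k i.
have y0 i : 0 <= point dt k i.
  by rewrite le_min n_ge0 mulr_ge0// mulr_ge0// ltW.
have kr i : k%:R * dt * w i <= r * w i by rewrite ler_wpM2r// rE lerDl ltW.
have h0 i : 0 <= h i.
  by rewrite subr_ge0 /point -/r le_min !ge_min lexx kr orbT.
have yhE i : point dt k i + h i = point dt k.+1 i by rewrite /h subrKC.
have yh i : point dt k i + h i <= r * w i by rewrite yhE ge_min lexx orbT.
have := path_step r0 y0 h0 yh.
have -> : (fun i => point dt k i + h i) = point dt k.+1 by exact/funext.
apply: le_trans; apply: ler_wpM2l; first by rewrite divr_ge0 ?path_gw_ge0// ltW.
rewrite -sumrB mulr_sumr; apply: ler_sum => i _; rewrite -mulrBr.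
have [w0|wn0] := eqVneq (w i) 0.
  by rewrite w0 pow000 mul0r !mulr_ge0 ?powR_ge0// ltW.
have w0 : 0 < w i by rewrite lt_neqAle eq_sym wn0/=.
rewrite pow00E//; have [nk|nk] := leP (n i) (k%:R * dt * w i).
  have pE j : (k <= j)%N -> point dt j i = n i.
    move=> kj; apply/min_idPl; apply: le_trans nk _.
    by rewrite ler_wpM2r// ler_wpM2r ?ler_nat// ltW.
  rewrite !pE// subrr mulr0 !mulr_ge0 ?powR_ge0//; exact: ltW.
have pk : point dt k i = k%:R * dt * w i by apply/min_idPr; exact: ltW.
have hE : point dt k.+1 i + dt * w i = r * w i + h i by rewrite /h pk rE; ring.
rewrite hE pk -mulrDl -rE.
have rw0 : 0 < r * w i by rewrite mulr_gt0.
have := @powR_le_tangent R p _ (r * w i + h i) (ltW p_gt0) p_le1 rw0.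
rewrite addr_ge0 ?(ltW rw0)// => /(_ isT); rewrite addrAC subrr add0r -lerBlDl.
move/(ler_wpM2l (powR_ge0 (w i) (1 - p))) => /le_trans; apply.
rewrite powRM ?(ltW r0)// [_ `^ (1 - p) * _]mulrC -(opprB p 1) powRN.
rewrite le_eqVlt; apply/orP; left; apply/eqP; field.
by rewrite gt_eqF// powR_gt0.
Qed.

(** Telescoping the steps bounds g at the end of the path; the initial potential dt^p N vanishes as
    dt tends to 0. *)
Lemma submodular_path_bound :
  g w * (\sum_i pow00 (n i) p * pow00 (w i) (1 - p)) <= N * g n.
Proof.
set S := \sum_i _.
have key dt : 0 < dt -> g w * (S - dt `^ p * N) <= N * g n.
  move=> dt0.
  have [K hK] : exists K : nat, forall i, 0 < w i -> n i <= K%:R * dt * w i.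
    pose B := \sum_i n i / (dt * w i).
    have t0 i : 0 <= n i / (dt * w i) by rewrite divr_ge0// mulr_ge0// ltW.
    have B0 : 0 <= B by exact: sumr_ge0.
    exists (Num.truncn B).+1 => i wi.
    rewrite -mulrA -ler_pdivrMr ?mulr_gt0//.
    apply: le_trans (ltW (proj2 (andP (Num.Theory.truncn_itv B0)))).
    by rewrite /B (bigD1 i)//= lerDl sumr_ge0.
  have tele k : g w / N * (potential dt k - potential dt 0) <= g (point dt k).
    elim: k => [|k IH].
      rewrite subrr mulr0 path_g0// => i; rewrite /point !mul0r.
      by apply/min_idPr.
    have := path_point_step k dt0; lra.
  (* The path ends at n only where w_i > 0 and stays at 0 elsewhere; monotonicity of g covers the
     rest. *)
  have gn : g (point dt K) <= g n.
    have -> : n = (fun i => point dt K i + (n i - point dt K i)).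
      by apply/funext => i; rewrite subrKC.
    apply: g_le_add => i; first by rewrite le_min n_ge0 mulr_ge0// mulr_ge0// ltW.
    by rewrite subr_ge0 ge_min lexx.
  have pK : S <= potential dt K.
    apply: ler_sum => i _; rewrite mulrC; have [w0|wn0] := eqVneq (w i) 0.
      by rewrite w0 pow000 !mul0r.
    have w0 : 0 < w i by rewrite lt_neqAle eq_sym wn0/=.
    rewrite ler_wpM2l ?pow00_ge0//.
    have -> : point dt K i = n i by apply/min_idPl; exact: hK.
    have dw0 : 0 <= dt * w i by rewrite mulr_ge0// ltW.
    apply: (@le_trans _ _ (n i `^ p)).
      by rewrite /pow00; case: ifP => // _; exact: powR_ge0.
    by apply: ge0_ler_powR; rewrite ?nnegrE ?addr_ge0 ?(ltW p_gt0)// lerDl.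
  have p00 : potential dt 0 = dt `^ p * N.
    rewrite -w_sum mulr_sumr; apply: eq_bigr => i _.
    rewrite /point !mul0r (_ : Order.min _ _ = 0); last exact/min_idPr.
    rewrite add0r powRM ?(ltW dt0)// mulrCA; congr (_ * _).
    have [->|wn0] := eqVneq (w i) 0; first by rewrite pow000 mul0r.
    by rewrite pow00E// -powRD ?wn0 ?implybT// subrK powRr1.
  have := le_trans (tele K) gn; rewrite -(ler_pM2l N_gt0) p00.
  set X := _ - _; have -> : N * (g w / N * X) = g w * X by field; rewrite gt_eqF.
  apply: le_trans; rewrite /X.
  by rewrite ler_wpM2l ?path_gw_ge0// lerD2r.
apply/ler_addgt0Pr => e e0.
have gN0 : 0 <= g w * N by rewrite mulr_ge0 ?path_gw_ge0// ltW.
have gN1 : 0 < g w * N + 1 by lra.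
have q0 : 0 < e / (g w * N + 1) by exact: divr_gt0.
have := key ((e / (g w * N + 1)) `^ p^-1); rewrite powR_gt0// => /(_ isT).
rewrite -powRrM mulVf ?gt_eqF// powRr1 ?(ltW q0)//.
have : g w * N * (e / (g w * N + 1)) <= e.
  by rewrite mulrA ler_pdivrMr// mulrC ler_pM2l//; lra.
lra.
Qed.

End SubmodularPath.

(** * Optimal designs *)

(** Comparison of first-order terms at t = 0, made explicit by (1 - t)^r >= 1 - r t and (1 - t a)^m
    <= e^(-t a m) <= 1 / (1 + t a m). *)
Lemma le_of_bernoulli (R : realType) (a : R) (r m : nat) : 0 <= a -> a <= 1 ->
  (forall t, 0 < t -> t < 1 -> (1 - t) ^+ r <= (1 - t * a) ^+ m) ->
  a * m%:R <= r%:R.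
Proof.
move=> a0 a1 h; rewrite leNgt; apply/negP => D.
have am0 : 0 <= a * m%:R by rewrite mulr_ge0.
have r0 : 0 <= r%:R :> R by [].
set c := a * m%:R in D am0 *; set q := r%:R in D r0 *.
(* Large enough that t = (c - q) / B satisfies both t < 1 and q c t < c - q. *)
pose B := q * c + (c - q) + 1.
have qc : 0 <= q * c by rewrite mulr_ge0.
have B0 : 0 < B by rewrite /B; lra.
pose t := (c - q) / B.
have t0 : 0 < t by rewrite divr_gt0// subr_gt0.
have t1 : t < 1 by rewrite ltr_pdivrMr// mul1r /B; lra.
have lower k : 1 - k%:R * t <= (1 - t) ^+ k.
  elim: k => [|k IH]; first by rewrite mul0r subr0 expr0.
  have u0 : 0 <= 1 - t by lra.
  have := ler_wpM2l u0 IH; rewrite exprS -natr1.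
  have := mulr_ge0 (mulr_ge0 (ler0n R k) (ltW t0)) (ltW t0).
  lra.
have upper : (1 - t * a) ^+ m * (1 + t * c) <= 1.
  have ta0 : 0 <= 1 - t * a.
    have := ler_pM (ltW t0) a0 (ltW t1) a1; lra.
  have h1 : (1 - t * a) ^+ m <= expR (- (t * c)).
    have -> : - (t * c) = - (t * a) * m%:R by rewrite /c; ring.
    rewrite expRM_natr lerXn2r ?nnegrE ?expR_ge0//.
    exact: expR_ge1Dx.
  have h2 := expR_ge1Dx (t * c).
  have : expR (- (t * c)) * expR (t * c) = 1 by rewrite -expRD addNr expR0.
  have : 0 <= 1 + t * c by rewrite addr_ge0// mulr_ge0// ltW.
  by move=> tc0 eE; rewrite -[leRHS]eE; apply: ler_pM => //; exact: exprn_ge0.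
have tc0 : 0 <= 1 + t * c by rewrite addr_ge0// mulr_ge0// ltW.
have := le_trans (ler_wpM2r tc0 (le_trans (lower r) (h t t0 t1))) upper.
rewrite -/q => hh.
have : t * (c - q) <= t * (q * c * t) by lra.
rewrite ler_pM2l// /t mulrA ler_pdivlMr// [q * c * _]mulrC ler_pM2l ?subr_gt0//.
by rewrite /B; lra.
Qed.

Section InfoMatrix.
Variables (R : realType) (s m N : nat) (M : 'I_s -> 'M[R]_m).
Hypotheses (m_gt0 : (0 < m)%N) (N_gt0 : (0 < N)%N).
Hypothesis M_psd : forall i, psd (M i).
Hypothesis M_full : \rank (\sum_(i < s) M i)%R = m.

Lemma info_mx_psd (w : 'I_s -> R) : (forall i, 0 <= w i) -> psd (info_mx M w).
Proof. by move=> w0; apply: psd_sum => i _; exact: psdZ. Qed.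

Lemma info_mxD (y z : 'I_s -> R) :
  info_mx M (fun i => y i + z i) = info_mx M y + info_mx M z.
Proof. by rewrite -big_split/=; apply: eq_bigr => i _; rewrite scalerDl. Qed.

Lemma info_mxZ (c : R) (y : 'I_s -> R) :
  info_mx M (fun i => c * y i) = c *: info_mx M y.
Proof. by rewrite scaler_sumr; apply: eq_bigr => i _; rewrite scalerA. Qed.

Lemma full_sum_unit : \sum_(i < s) M i \in unitmx.
Proof. by rewrite -row_free_unit /row_free M_full. Qed.

Lemma full_s_gt0 : (0 < s)%N.
Proof.
rewrite lt0n; apply/negP => /eqP s0; move: M_full m_gt0.
rewrite big1 ?mxrank0 => [<-//|i _]; exfalso.
by have := ltn_ord i; rewrite [X in (_ < X)%N]s0.
Qed.

(** A feasible competitor with invertible information matrix, which forces the optimal value to be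
    positive. *)
Let uniform : 'I_s -> R := fun=> N%:R / s%:R.

Lemma uniform_gt0 : 0 < N%:R / s%:R :> R.
Proof. by rewrite divr_gt0 ?ltr0n// full_s_gt0. Qed.

Lemma uniform_feasible : feasible N uniform.
Proof.
split=> [i|]; first exact: ltW uniform_gt0.
rewrite sumr_const card_ord -[_ *+ s]mulr_natr divfK//.
by rewrite pnatr_eq0 -lt0n full_s_gt0.
Qed.

Lemma uniform_info : info_mx M uniform = (N%:R / s%:R) *: \sum_(i < s) M i.
Proof. by rewrite scaler_sumr. Qed.

(** Rescaling w to total N would strictly increase a positive value homogeneous of positive degree.
    The degree is p for the trace criterion and m for the determinant. *)
Lemma optimal_weight_sum (e : R) (g : ('I_s -> R) -> R) (w : 'I_s -> R) :
  0 < e ->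
  (forall c y, 0 <= c -> (forall i, 0 <= y i) -> g (fun i => c * y i) = c `^ e * g y) ->
  feasible N w -> (forall y, feasible N y -> g y <= g w) -> 0 < g w ->
  \sum_i w i = N%:R.
Proof.
move=> e0 gZ [w0 wN] gmax gw0; apply/eqP; rewrite eq_le wN leNgt /=.
apply/negP => lt; set sg := \sum_i w i in lt wN *.
have sg0 : 0 < sg.
  rewrite lt_neqAle sumr_ge0// andbT eq_sym; apply/negP => /eqP sg0.
  have wz i : w i = 0.
    have /eqP := sg0; rewrite psumr_eq0// => /allP/(_ i).
    by rewrite mem_index_enum => /(_ isT)/eqP.
  move: gw0; rewrite (_ : w = (fun i => 0 * w i)); last first.
    by apply/funext => i; rewrite mul0r.
  by rewrite gZ// powR0 ?gt_eqF// mul0r ltxx.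
have c1 : 1 < N%:R / sg by rewrite ltr_pdivlMr// mul1r.
have c0 : 0 <= N%:R / sg by rewrite ltW// (lt_trans ltr01).
have := gmax (fun i => N%:R / sg * w i) _; rewrite gZ//.
have fs : feasible N (fun i => N%:R / sg * w i).
  split=> [i|]; first exact: mulr_ge0.
  by rewrite -mulr_sumr -/sg divfK// gt_eqF.
move=> /(_ fs); rewrite -{2}[g w]mul1r ler_pM2r// leNgt.
have := gt0_ltr_powR e0 (_ : 1 \in Num.nneg) (_ : N%:R / sg \in Num.nneg) c1.
by rewrite powR1 !nnegrE c0 ler01 => ->.
Qed.

Lemma Phi_pos_le (p : R) (A B : 'M[R]_m) : 0 < p ->
  Phi p A <= Phi p B -> trace_pow p A <= trace_pow p B.
Proof.
move=> p0; rewrite /Phi gt_eqF// leNgt => AB; rewrite leNgt; apply: contra AB => BA.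
have mi : 0 < m%:R^-1 :> R by rewrite invr_gt0 ltr0n.
apply: gt0_ltr_powR; rewrite ?invr_gt0// ?nnegrE ?mulr_ge0 ?(ltW mi) ?trace_pow_ge0//.
by rewrite ltr_pM2l.
Qed.

Lemma Phi0_le (A B : 'M[R]_m) : psd A -> psd B ->
  Phi 0 A <= Phi 0 B -> \det A <= \det B.
Proof.
move=> pA pB; rewrite /Phi eqxx leNgt => AB; rewrite leNgt; apply: contra AB => BA.
by apply: gt0_ltr_powR; rewrite ?invr_gt0 ?ltr0n// nnegrE psd_det_ge0.
Qed.

Lemma phi_pos_ratio_ge (p : R) (w : 'I_s -> R) (n : 'I_s -> nat) :
  0 < p -> p <= 1 -> continuous_optimal M p N w ->
  [/\ 0 < phi M p w, \sum_i w i = N%:R &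
    (\sum_i pow00 (n i)%:R p * pow00 (w i) (1 - p)) / N%:R
      <= phi M p (natv R n) / phi M p w].
Proof.
move=> p0 p1 [wf opt]; have [w0 wN] := wf.
have gmax y : feasible N y -> phi M p y <= phi M p w.
  by move=> /opt; exact: Phi_pos_le.
have gZ c y : 0 <= c -> (forall i, 0 <= y i) ->
    phi M p (fun i => c * y i) = c `^ p * phi M p y.
  by move=> c0 y0; rewrite /phi info_mxZ trace_powZ//; exact: info_mx_psd.
have gw0 : 0 < phi M p w.
  apply: lt_le_trans (gmax _ uniform_feasible).
  have pS : psd (\sum_(i < s) M i) by exact: psd_sum.
  rewrite /phi uniform_info trace_powZ// ?(ltW uniform_gt0)//.
  by rewrite mulr_gt0 ?powR_gt0 ?uniform_gt0// trace_pow_gt0// full_sum_unit.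
have ws := optimal_weight_sum p0 gZ wf gmax gw0.
split=> //; have N0 : 0 < N%:R :> R by rewrite ltr0n.
rewrite ler_pdivrMr// mulrAC ler_pdivlMr// [leLHS]mulrC [leRHS]mulrC.
apply: (@submodular_path_bound _ _ _ _ (phi M p) w (natv R n) p0 p1 N0 w0 ws
  (fun i => ler0n R (n i)) _ _ gZ) => [y d h y0 d0 h0|y d y0 d0|y y0 yN].
- rewrite /phi (info_mxD (fun i => y i + d i)) !info_mxD.
  exact: (trace_pow_submodular p0 p1 (info_mx_psd y0) (info_mx_psd d0) (info_mx_psd h0)).
- rewrite /phi info_mxD.
  exact: (trace_pow_le_add p0 p1 (info_mx_psd y0) (info_mx_psd d0)).
- exact: gmax.
Qed.

Lemma phi0_ratio_ge (w : 'I_s -> R) (n : 'I_s -> nat) :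
  continuous_optimal M 0 N w ->
  [/\ phi M 0 w = m%:R, \sum_i w i = N%:R &
    (\sum_i pow00 (n i)%:R 0 * pow00 (w i) (1 - 0)) / N%:R
      <= phi M 0 (natv R n) / phi M 0 w].
Proof.
move=> [wf opt]; have [w0 wN] := wf.
pose g y := \det (info_mx M y).
have gmax y : feasible N y -> g y <= g w.
  by move=> yf; apply: Phi0_le (opt _ yf); apply: info_mx_psd => //; case: yf.
have gZ c y : 0 <= c -> (forall i, 0 <= y i) ->
    g (fun i => c * y i) = c `^ m%:R * g y.
  by move=> c0 _; rewrite /g info_mxZ detZ powR_mulrn.
have pS : psd (\sum_(i < s) M i) by exact: psd_sum.
have gw0 : 0 < g w.
  apply: lt_le_trans (gmax _ uniform_feasible).
  rewrite /g uniform_info detZ mulr_gt0 ?exprn_gt0 ?uniform_gt0//.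
  by rewrite -psd_unitE// full_sum_unit.
have m0 : 0 < m%:R :> R by rewrite ltr0n.
have N0 : 0 < N%:R :> R by rewrite ltr0n.
have ws := optimal_weight_sum m0 gZ wf gmax gw0.
have pX := info_mx_psd w0.
have phiw : phi M 0 w = m%:R.
  rewrite /phi /trace_pow eqxx; congr (_%:R); apply: mxrank_unit.
  by rewrite psd_unitE.
split=> //; rewrite phiw.
pose on i := if (0 < n i)%N then w i else 0.
pose off i := if (0 < n i)%N then 0 else w i.
have on0 i : 0 <= on i by rewrite /on; case: ifP.
have off0 i : 0 <= off i by rewrite /off; case: ifP.
have wE : w = (fun i => off i + on i).
  by apply/funext => i; rewrite /on /off; case: ifP; rewrite ?addr0 ?add0r.
(* By 0^0 = 0, the sum S at p = 0 is the weight carried by the support of n. *)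
have -> : \sum_i pow00 (n i)%:R 0 * pow00 (w i) (1 - 0) = \sum_i on i.
  apply: eq_bigr => i _; rewrite /on subr0 lt0n.
  have -> : pow00 (w i) 1 = w i.
    by rewrite /pow00; case: eqP => [->//|_]; rewrite powRr1.
  have [->|ni0] /= := eqVneq (n i) 0%N; first by rewrite pow000 mul0r.
  by rewrite pow00E ?pnatr_eq0// powRr0 mul1r.
set a := (\sum_i on i) / N%:R.
have a0 : 0 <= a by rewrite divr_ge0// sumr_ge0.
have a1 : a <= 1.
  rewrite ler_pdivrMr// mul1r -ws; apply: ler_sum => i _.
  by rewrite /on; case: ifP.
set V := info_mx M on; have pV : psd V by exact: info_mx_psd.
have pW : psd (info_mx M off) by exact: info_mx_psd.
have XE : info_mx M w = info_mx M off + V by rewrite {1}wE info_mxD.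
(* Where n_i > 0, n_i >= 1 >= w_i / N, so M_F(n) is V / N plus a psd matrix. *)
have rankV : (\rank V <= \rank (info_mx M (natv R n)))%N.
  have -> : natv R n = (fun i => N%:R^-1 * on i + ((n i)%:R - N%:R^-1 * on i)).
    by apply/funext => i; rewrite subrKC.
  have wi1 i : w i <= N%:R.
    by rewrite -ws (bigD1 i)//= lerDl sumr_ge0.
  have d0 i : 0 <= (n i)%:R - N%:R^-1 * on i.
    rewrite subr_ge0 /on; case: ifP => [ni|_]; last by rewrite mulr0.
    rewrite ler_pdivrMl//; apply: le_trans (wi1 i) _.
    by rewrite ler_peMr ?ler1n ?ler0n.
  have Ni0 : 0 < N%:R^-1 :> R by rewrite invr_gt0.
  rewrite info_mxD info_mxZ.
  apply: leq_trans (rank_psd_sub (psdZ (ltW Ni0) pV) (info_mx_psd d0)).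
  by rewrite mxrank_scale_nz// gt_eqF.
have aV : a * m%:R <= (\rank V)%:R.
  apply: le_of_bernoulli => // t t0 t1.
  have ta : 0 < 1 - t * a.
    have : t * a <= t * 1 by rewrite ler_wpM2l// ltW.
    lra.
  (* Damping the supported weight by 1 - t leaves total (1 - t a) N; rescaling to N contributes the
     power (1 - t a)^m to the determinant comparison. *)
  pose w' i := (1 - t * a)^-1 * (off i + (1 - t) * on i).
  have t1' : 0 <= 1 - t by lra.
  have offs : \sum_i off i = N%:R - a * N%:R.
    have := ws; rewrite {1}wE big_split /= /a divfK ?gt_eqF// => <-.
    by rewrite addrK.
  have w'f : feasible N w'.
    split=> [i|]; first by rewrite mulr_ge0 ?invr_ge0 ?(ltW ta)// addr_ge0// mulr_ge0.
    rewrite -mulr_sumr big_split /= -mulr_sumr offs.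
    have -> : \sum_i on i = a * N%:R by rewrite /a divfK// gt_eqF.
    by rewrite ler_pdivrMl// le_eqVlt; apply/orP; left; apply/eqP; ring.
  have := gmax _ w'f; rewrite /g /w' info_mxZ info_mxD info_mxZ -/V detZ exprVn.
  rewrite ler_pdivrMl ?exprn_gt0// => hmax.
  have t2 : 1 - t <= 1 by lra.
  have := le_trans (det_scale_rank pW pV t1' t2) hmax.
  by rewrite -XE ler_pM2r.
rewrite /phi /trace_pow eqxx ler_pdivlMr//; apply: le_trans aV _.
by rewrite ler_nat.
Qed.

End InfoMatrix.

(** * Transport along the sorting permutation and the final guarantee *)

Lemma rounding_output_ge (R : realType) (s N : nat) (p : R) (w : 'I_s -> R)
    (n : 'I_s -> nat) :
  (0 < s)%N -> (0 < N)%N -> 0 <= p -> p <= 1 ->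
  (forall i, 0 <= w i) -> \sum_i w i = N%:R -> rounding_output p N w n ->
  (\sum_i n i = N)%N /\
  Fbound p N s <= (\sum_i pow00 (n i)%:R p * pow00 (w i) (1 - p)) / N%:R.
Proof.
move=> s0 N0 p0 p1 w0 wN [sigma [n' [sorted run nE]]].
have ws0 i : 0 <= w (sigma i) by [].
have wsN : \sum_i w (sigma i) = N%:R.
  by rewrite -wN [RHS](reindex_inj (@perm_inj _ sigma)).
split.
  rewrite (reindex_inj (@perm_inj _ sigma))/=; under eq_bigr => i _ do rewrite nE.
  by have [] := greedy_run_marginals s0 p0 p1 ws0 sorted run.
rewrite (reindex_inj (@perm_inj _ sigma))/=; under eq_bigr => i _ do rewrite nE.
by apply: Fbound_le => // x0 x00 sg; apply: greedy_ge_line.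
Qed.

Local Close Scope classical_set_scope.
Unset Implicit Arguments.

Theorem theorem3p8 (R : realType) (s m N : nat) (M : 'I_s -> 'M[R]_m) (p : R)
    (wstar : 'I_s -> R) (n nstar : 'I_s -> nat)
    (m_gt0 : (0 < m)%N) (N_gt0 : (0 < N)%N)
    (M_psd : forall i, psd (M i))
    (M_full : \rank (\sum_(i < s) M i)%R = m)
    (p_ge0 : 0 <= p) (p_le1 : p <= 1)
    (wstar_opt : continuous_optimal M p N wstar)
    (n_out : rounding_output p N wstar n)
    (nstar_opt : integer_optimal M p N nstar) :
  [/\ phi M p (natv R n) / phi M p wstar
        <= phi M p (natv R n) / phi M p (natv R nstar),
      Fbound p N s <= phi M p (natv R n) / phi M p wstar,
      (N%:R / s%:R <= expR (- 1) :> R -> Fcond p N s),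
      (2^-1 <= N%:R / s%:R :> R -> Fbound p N s = Flarge p N s) &
      (2^-1 <= N%:R / s%:R :> R -> p < 1 -> 0 < p \/ 2^-1 < N%:R / s%:R :> R ->
        ~~ Fcond p N s)].
Proof.
have [wf opt] := wstar_opt; have [w0 _] := wf.
have s_gt0 : (0 < s)%N by exact: full_s_gt0 m_gt0 M_full.
have [phiw0 wsum ratio nstar_le] : [/\ 0 < phi M p wstar,
    \sum_i wstar i = N%:R,
    (\sum_i pow00 (n i)%:R p * pow00 (wstar i) (1 - p)) / N%:R
      <= phi M p (natv R n) / phi M p wstar &
    phi M p (natv R nstar) <= phi M p wstar].
  have [p0|pn0] := eqVneq p 0.
    have opt0 : continuous_optimal M 0 N wstar by rewrite -p0.
    have [phiw wsum ratio] := phi0_ratio_ge m_gt0 N_gt0 M_psd M_full n opt0.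
    rewrite p0; split=> //; first by rewrite phiw ltr0n.
    (* At p = 0 the optimal w has full rank m, which no rank exceeds. *)
    by rewrite phiw /phi /trace_pow eqxx ler_nat rank_leq_row.
  have p_gt0 : 0 < p by rewrite lt_neqAle eq_sym pn0.
  have [phiw wsum ratio] := phi_pos_ratio_ge m_gt0 N_gt0 M_psd M_full n p_gt0 p_le1 wstar_opt.
  split=> //; apply: (Phi_pos_le m_gt0 p_gt0); apply: opt; split=> [i|].
    exact: ler0n.
  by rewrite -natr_sum ler_nat; case: nstar_opt.
have [nsum Fle] := rounding_output_ge s_gt0 N_gt0 p_ge0 p_le1 w0 wsum n_out.
have n_le : phi M p (natv R n) <= phi M p (natv R nstar).
  by apply: nstar_opt.2; rewrite nsum.
have phi_ge0 v : 0 <= phi M p v.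
  have [->|pn0] := eqVneq p 0; first by rewrite /phi /trace_pow eqxx.
  by rewrite trace_pow_ge0// lt_neqAle eq_sym pn0.
split.
(* Division by zero returns 0; if the value at n^* is 0, optimality makes the value at n vanish too,
   and both quotients are 0. *)
- have := phi_ge0 (natv R nstar); rewrite le_eqVlt => /predU1P[z|nstar0].
    have -> : phi M p (natv R n) = 0 by apply/eqP; rewrite eq_le {1}z n_le phi_ge0.
    by rewrite !mul0r.
  apply: ler_wpM2l; first exact: phi_ge0.
  by rewrite (lef_pV2 phiw0 nstar0).
- exact: le_trans Fle ratio.
- exact: Fcond_small_ratio.
- exact: Fbound_large_ratio.
- by move=> h p1; exact: FcondN_large_ratio.
Qed.
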